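(* Let $X$ be a four-dimensional manifold with a Lorentzian metric $g$ of signature $(-,+,+,+)$, let $\kappa^2>0$ be a constant and $k:=-2\sqrt{-g}/\kappa^2$, and let $V=T^*X\otimes\operatorname{Sym}^2T^*X$ denote the ($40$-dimensional) fiber at a point, consisting of tensors $Q_{\rho\mu\nu}=Q_{\rho\nu\mu}$. Let $\mathcal B:V\to V$ and $\mathcal C:V\to V$ be the linear maps $$(\mathcal BQ)_{\rho\mu\nu}=-\tfrac12Q_{\rho\mu\nu}+\tfrac12Q_{\mu\nu\rho}+\tfrac12Q_{\nu\mu\rho}+\tfrac12(Q_\rho-\widetilde Q_\rho)g_{\mu\nu}-\tfrac14(g_{\rho\mu}Q_\nu+g_{\rho\nu}Q_\mu),$$ $$(\mathcal C\Pi)_{\rho\mu\nu}=\Pi_{\mu\nu\rho}+\Pi_{\nu\mu\rho}+\tfrac13\bigl(g_{\mu\nu}(\Pi_\rho-2\widetilde\Pi_\rho)-g_{\rho\mu}(\Pi_\nu+\widetilde\Pi_\nu)-g_{\rho\nu}(\Pi_\mu+\widetilde\Pi_\mu)\bigr).$$ The STEGR momentum map is $\Pi=k\,\mathcal BQ$ (indices moved with $g$). Then: (i) $\mathcal C\mathcal B=\mathcal B\mathcal C=\operatorname{id}_V$, so the momentum map is inverted by $Q=k^{-1}\mathcal C\,\Pi$. (ii) On the double-trace-free subspace $V_0=\{Q\in V:\ Q_\rho=0,\ \widetilde Q_\rho=0\}$, the endomorphism $\mathcal B$ has eigenvalues $\tfrac12$ and $-1$; on the traces, $\mathcal B$ acts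 by a $2\times2$ trace-mixing matrix (sending $(Q_\rho,\widetilde Q_\rho)$ to the two traces $(p_\rho,\widetilde p_\rho)$ of $p=\mathcal BQ$) of determinant $-\tfrac34$. (iii) The field-strength Hessian has no zero modes (its kernel on $V$ is trivial), so no gauge fixing is needed to invert the momentum map. (iv) The Hessian on $V$ of the quadratic form $$\mathbb Q=-\tfrac14Q_{\rho\mu\nu}Q^{\rho\mu\nu}+\tfrac12Q_{\rho\mu\nu}Q^{\mu\nu\rho}+\tfrac14Q_\mu Q^\mu-\tfrac12Q_\mu\widetilde Q^\mu$$ has inertia $22$ positive and $18$ negative, and the physical Hessian $M=k\mathcal B$ (viewed as a symmetric bilinear form on $V$ using $g$) has inertia $18$ positive and $22$ negative. (v) Written with unrestricted indices, with $M=k\mathcal B$ and $M^{-1}=k^{-1}\mathcal C$, the inverse contractions (in either order) equal the symmetric-pair projector: $$M_{\rho\mu\nu|\sigma\alpha\beta}\,(M^{-1})^{\sigma\alpha\beta|\tau\gamma\delta}=\delta_\rho^\tau\,\delta^{\gamma}_{(\mu}\delta^{\delta}_{\nu)}.$$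
   Context: Traces: for any tensor $X_{\rho\mu\nu}=X_{\rho\nu\mu}$, $X_\rho:=X_{\rho\lambda}{}^\lambda=g^{\mu\nu}X_{\rho\mu\nu}$ and $\widetilde X_\rho:=X_{\lambda\rho}{}^\lambda=g^{\lambda\nu}X_{\lambda\rho\nu}$; this is applied to both $Q$ and $\Pi$. Indices are raised and lowered with $g$. Symmetrization is weighted: $A_{(\mu\nu)}=\tfrac12(A_{\mu\nu}+A_{\nu\mu})$. STEGR (symmetric teleparallel equivalent of general relativity) has bulk Lagrangian density $\sqrt{-g}\,\mathcal L=-\frac{2}{\kappa^2}\sqrt{-g}\,\mathbb Q$, where $Q_{\rho\mu\nu}=\nabla_\rho g_{\mu\nu}$ is the nonmetricity; the momentum is $\Pi^{\rho\mu\nu}=\partial(\sqrt{-g}\,\mathcal L)/\partial Q_{\rho\mu\nu}$ and the field-strength Hessian is the second derivative of $\sqrt{-g}\,\mathcal L$ with respect to $Q\in V$ at fixed $g$. The Hessian is a map $V\to V^*$, identified with an endomorphism of $V$ by the metric contraction $\langle X,Y\rangle=X_{\rho\mu\nu}Y^{\rho\mu\nu}$. Inertia means the numbers of positive and negative directions of the symmetric bilinear form. *)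

(* Defs.v *)
From HB Require Import structures.
From mathcomp Require Import all_boot all_order all_algebra.
From mathcomp Require Import all_classical all_reals all_analysis.
From mathcomp Require Import ring.

Set Implicit Arguments.
Unset Strict Implicit.
Unset Printing Implicit Defensive.
Import Order.TTheory GRing.Theory Num.Theory.
Import numFieldNormedType.Exports.
Local Open Scope ring_scope.

(** Inertia: [p] positive and [n] negative directions of a symmetric bilinear
    form on [U], read off an orthogonal basis of [U] (Sylvester's law makes the
    two numbers independent of the basis). *)

Definition sym_bilinear_on (R : realType) (vT : vectType R) (U : {vspace vT})
    (b : vT -> vT -> R) : Prop :=
  {in U &, forall u v, b u v = b v u} /\
  (forall a, {in U & &, forall u v w, b (a *: u + v) w = a * b u w + b v w}).

Definition has_inertia (R : realType) (vT : vectType R) (U : {vspace vT})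
    (b : vT -> vT -> R) (p n : nat) : Prop :=
  sym_bilinear_on U b /\
  exists e : (\dim U).-tuple vT,
    [/\ basis_of U e,
        forall i j : 'I_(\dim U), i != j -> b (tnth e i) (tnth e j) = 0,
        #|[set i | 0 < b (tnth e i) (tnth e i)]| = p &
        #|[set i | b (tnth e i) (tnth e i) < 0]| = n].

(** [g m n] are the components of the metric in an arbitrary basis of the
    four-dimensional tangent space; they need not be the Minkowski ones. *)
Definition lorentzian (R : realType) (g : 'M[R]_4) : Prop :=
  g^T = g /\
  has_inertia fullv (fun u v : 'rV[R]_4 => (u *m g *m v^T) 0 0) 3 1.

(** Arrays of 64 components [Q r m n] with unrestricted indices; the matrix
    carrier provides both the vector space and the normed structure. *)
Notation tensor3 R := 'M[R]_(4, 4 * 4).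

Definition cpt (R : realType) (Q : tensor3 R) (r m n : 'I_4) : R :=
  Q r (mxvec_index m n).

Definition mkT (R : realType) (F : 'I_4 -> 'I_4 -> 'I_4 -> R) : tensor3 R :=
  \matrix_(r < 4) mxvec (\matrix_(m < 4, n < 4) F r m n).

Lemma cpt_mkT (R : realType) (F : 'I_4 -> 'I_4 -> 'I_4 -> R) r m n :
  cpt (mkT F) r m n = F r m n.
Proof. by rewrite /cpt /mkT mxE mxvecE mxE. Qed.

Lemma tensor3P (R : realType) (P Q : tensor3 R) :
  (forall r m n, cpt P r m n = cpt Q r m n) -> P = Q.
Proof. by move=> eqPQ; apply/matrixP => r k; case/mxvec_indexP: k => m n; apply: eqPQ. Qed.

Lemma cptP (R : realType) a (P Q : tensor3 R) r m n :
  cpt (a *: P + Q) r m n = a * cpt P r m n + cpt Q r m n.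
Proof. by rewrite /cpt !mxE. Qed.

(** The fibre of [T^*X (x) Sym^2 T^*X]; see [symVP] for the membership test. *)
Definition pair_skew (R : realType) (Q : tensor3 R) : tensor3 R :=
  mkT (fun r m n => cpt Q r m n - cpt Q r n m).

Fact pair_skew_is_linear (R : realType) : linear (@pair_skew R).
Proof.
by move=> a P Q; apply: tensor3P => r m n; rewrite !(cptP, cpt_mkT); ring.
Qed.
HB.instance Definition _ (R : realType) :=
  GRing.isLinear.Build R (tensor3 R) (tensor3 R) *:%R (@pair_skew R)
    (@pair_skew_is_linear R).

Definition symV (R : realType) : {vspace tensor3 R} :=
  lker (linfun (@pair_skew R)).

Lemma symVP (R : realType) (Q : tensor3 R) :
  reflect (forall r m n, cpt Q r m n = cpt Q r n m) (Q \in symV R).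
Proof.
rewrite memv_ker lfunE /=; apply: (iffP eqP) => [Q0 r m n | symQ].
  apply/eqP; rewrite -subr_eq0; apply/eqP.
  by rewrite -(cpt_mkT (fun r m n => cpt Q r m n - cpt Q r n m)) [mkT _]Q0 /cpt mxE.
by apply: tensor3P => r m n; rewrite cpt_mkT symQ subrr /cpt mxE.
Qed.

Definition tr1 (R : realType) (g : 'M[R]_4) (Q : tensor3 R) : 'rV[R]_4 :=
  \row_(r < 4) \sum_(m < 4) \sum_(n < 4) invmx g m n * cpt Q r m n.

Definition tr2 (R : realType) (g : 'M[R]_4) (Q : tensor3 R) : 'rV[R]_4 :=
  \row_(r < 4) \sum_(l < 4) \sum_(n < 4) invmx g l n * cpt Q l r n.

Lemma tr1P (R : realType) (g : 'M[R]_4) a (P Q : tensor3 R) :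
  tr1 g (a *: P + Q) = a *: tr1 g P + tr1 g Q.
Proof.
apply/rowP => r; rewrite !mxE mulr_sumr -big_split; apply: eq_bigr => m _ /=.
by rewrite mulr_sumr -big_split; apply: eq_bigr => n _ /=; rewrite cptP; ring.
Qed.

Lemma tr2P (R : realType) (g : 'M[R]_4) a (P Q : tensor3 R) :
  tr2 g (a *: P + Q) = a *: tr2 g P + tr2 g Q.
Proof.
apply/rowP => r; rewrite !mxE mulr_sumr -big_split; apply: eq_bigr => m _ /=.
by rewrite mulr_sumr -big_split; apply: eq_bigr => n _ /=; rewrite cptP; ring.
Qed.

Definition move_indices (R : realType) (h : 'M[R]_4) (Q : tensor3 R) :
    tensor3 R :=
  mkT (fun r m n => \sum_(a < 4) \sum_(b < 4) \sum_(c < 4)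
    h r a * h m b * h n c * cpt Q a b c).

Definition raise3 (R : realType) (g : 'M[R]_4) : tensor3 R -> tensor3 R :=
  move_indices (invmx g).

Definition lower3 (R : realType) (g : 'M[R]_4) : tensor3 R -> tensor3 R :=
  move_indices g.

Definition pairing (R : realType) (g : 'M[R]_4) (P Q : tensor3 R) : R :=
  \sum_(r < 4) \sum_(m < 4) \sum_(n < 4) cpt P r m n * cpt (raise3 g Q) r m n.

Definition vpairing (R : realType) (g : 'M[R]_4) (u v : 'rV[R]_4) : R :=
  \sum_(m < 4) \sum_(n < 4) invmx g m n * u 0 m * v 0 n.

Definition opB (R : realType) (g : 'M[R]_4) (Q : tensor3 R) : tensor3 R :=
  mkT (fun r m n =>
    - (1 / 2) * cpt Q r m n + (1 / 2) * cpt Q m n r + (1 / 2) * cpt Q n m r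
    + (1 / 2) * (tr1 g Q 0 r - tr2 g Q 0 r) * g m n
    - (1 / 4) * (g r m * tr1 g Q 0 n + g r n * tr1 g Q 0 m)).

Definition opC (R : realType) (g : 'M[R]_4) (P : tensor3 R) : tensor3 R :=
  mkT (fun r m n =>
    cpt P m n r + cpt P n m r
    + (1 / 3) * (g m n * (tr1 g P 0 r - 2 * tr2 g P 0 r)
                 - g r m * (tr1 g P 0 n + tr2 g P 0 n)
                 - g r n * (tr1 g P 0 m + tr2 g P 0 m))).

Fact opB_is_linear (R : realType) (g : 'M[R]_4) : linear (opB g).
Proof.
move=> a P Q; apply: tensor3P => r m n.
by rewrite !(cptP, cpt_mkT) tr1P tr2P !mxE; ring.
Qed.
HB.instance Definition _ (R : realType) (g : 'M[R]_4) :=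
  GRing.isLinear.Build R (tensor3 R) (tensor3 R) *:%R (opB g)
    (opB_is_linear g).

Fact opC_is_linear (R : realType) (g : 'M[R]_4) : linear (opC g).
Proof.
move=> a P Q; apply: tensor3P => r m n.
by rewrite !(cptP, cpt_mkT) tr1P tr2P !mxE; ring.
Qed.
HB.instance Definition _ (R : realType) (g : 'M[R]_4) :=
  GRing.isLinear.Build R (tensor3 R) (tensor3 R) *:%R (opC g)
    (opC_is_linear g).

Definition V0 (R : realType) (g : 'M[R]_4) (Q : tensor3 R) : Prop :=
  [/\ Q \in symV R, tr1 g Q = 0 & tr2 g Q = 0].

Definition nonmet (R : realType) (g : 'M[R]_4) (Q : tensor3 R) : R :=
  - (1 / 4) * pairing g Q Q
  + (1 / 2) * (\sum_(r < 4) \sum_(m < 4) \sum_(n < 4)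
                 cpt Q r m n * cpt (raise3 g Q) m n r)
  + (1 / 4) * vpairing g (tr1 g Q) (tr1 g Q)
  - (1 / 2) * vpairing g (tr1 g Q) (tr2 g Q).

(** The bulk STEGR Lagrangian density as a function of the nonmetricity at
    fixed metric. *)
Definition lagrangian (R : realType) (g : 'M[R]_4) (kappa : R)
    (Q : tensor3 R) : R :=
  - (2 / kappa ^+ 2) * Num.sqrt (- \det g) * nonmet g Q.

Definition coupling (R : realType) (g : 'M[R]_4) (kappa : R) : R :=
  - 2 * Num.sqrt (- \det g) / kappa ^+ 2.

(** The coordinate array with a 1 in position [(s, a, b)], symmetrized with
    weight one in its last two indices. *)
Definition symunit (R : realType) (s a b : 'I_4) : tensor3 R :=
  mkT (fun r m n => (r == s)%:R *
    (1 / 2 * ((m == a)%:R * (n == b)%:R + (m == b)%:R * (n == a)%:R))).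

(** Components with upper indices.  The derivative with respect to
    [Q_{rmn} = Q_{rnm}] is normalized by [dL = Pi^{rmn} dQ_{rmn}], summed over
    unrestricted indices, with [Pi^{rmn} = Pi^{rnm}]. *)
Definition momentum (R : realType) (g : 'M[R]_4) (kappa : R) (Q : tensor3 R) :
    tensor3 R :=
  mkT (fun r m n => 'D_(symunit R r m n) (lagrangian g kappa) Q).

Definition hessian (R : realType) (f : tensor3 R -> R) (Q u v : tensor3 R) :
    R :=
  'D_u (fun P => 'D_v f P) Q.

(** Components of an endomorphism of [V] with unrestricted indices:
    [A_{rmn}^{sab}] is symmetric in [(a, b)] and satisfies
    [(A Q)_{rmn} = A_{rmn}^{sab} Q_{sab}] on [V].  The second group is then
    lowered, or the first one raised. *)
Definition lower_cpt (R : realType) (g : 'M[R]_4)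
    (A : tensor3 R -> tensor3 R) (r m n s a b : 'I_4) : R :=
  cpt (lower3 g (mkT (fun s' a' b' => cpt (A (symunit R s' a' b')) r m n)))
    s a b.

Definition upper_cpt (R : realType) (g : 'M[R]_4)
    (A : tensor3 R -> tensor3 R) (s a b t c d : 'I_4) : R :=
  cpt (raise3 g (A (symunit R t c d))) s a b.

(* Main.v *)
Require Import Defs.
From HB Require Import structures.
From mathcomp Require Import all_boot all_order all_algebra.
From mathcomp Require Import all_classical all_reals all_analysis.
From mathcomp Require Import ring lra.
Set Implicit Arguments.
Unset Strict Implicit.
Unset Printing Implicit Defensive.
Import Order.TTheory GRing.Theory Num.Theory.
Import numFieldNormedType.Exports.
Local Open Scope ring_scope.

(** The double traces of [B Q] and [C P] are linear in those of [Q] and [P], so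
    [C B = B C = id] is an identity between components; on the trace-free part
    [C = 2 B + 1], hence [(2 B - 1) (B + 1) = 0] there.  The polar form of
    [nonmet] is [<B u, v>], which makes the Hessian nondegenerate.

    For the inertia, pass to a [g]-orthogonal frame with inverse metric
    [diag(w_0, ..., w_3)].  Reflections of the frame split [Sym^2] valued
    covectors into four 7-dimensional blocks (the components with one index [i]
    and a repeated pair), on which the form is [w_i] times a form of inertia
    (4, 3), and four 3-dimensional blocks (the permutations of the three indices
    other than [i]), on which it is [prod_(j != i) w_j] times a form of inertia
    (1, 2).  As [prod_j w_j < 0], an index [i] contributes (6, 4) if [w_i > 0]
    and (4, 6) if [w_i < 0]; the total is 3 (6, 4) + (4, 6) = (22, 18). *)

(** * Three-index tensors *)

Section Tensors.
Variable R : realType.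
Implicit Types (P Q u v : tensor3 R) (h g : 'M[R]_4).

(** Contraction without a metric. [pairing g P Q] is [dot3] with [Q] raised, so adjoints and frame
    changes are worked out once for plain sums. *)
Definition dot3 P Q : R :=
  \sum_(r < 4) \sum_(m < 4) \sum_(n < 4) cpt P r m n * cpt Q r m n.

Definition cyc Q : tensor3 R := mkT (fun r m n => cpt Q m n r).

Lemma cptD P Q r m n : cpt (P + Q) r m n = cpt P r m n + cpt Q r m n.
Proof. by rewrite /cpt mxE. Qed.

Lemma cptZ a Q r m n : cpt (a *: Q) r m n = a * cpt Q r m n.
Proof. by rewrite /cpt mxE. Qed.

Lemma cpt0 r m n : cpt (0 : tensor3 R) r m n = 0.
Proof. by rewrite /cpt mxE. Qed.

Lemma sum3_pair (F : 'I_4 -> 'I_4 -> 'I_4 -> R) :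
  \sum_(a < 4) \sum_(b < 4) \sum_(c < 4) F a b c =
  \sum_(p : 'I_4 * 'I_4 * 'I_4) F p.1.1 p.1.2 p.2.
Proof.
rewrite pair_bigA /= pair_bigA /=.
by apply: eq_bigr => -[[]].
Qed.

Lemma sum3_prod (F G H : 'I_4 -> R) :
  \sum_(a < 4) \sum_(b < 4) \sum_(c < 4) F a * G b * H c =
  (\sum_a F a) * (\sum_b G b) * (\sum_c H c).
Proof.
rewrite !mulr_suml; apply: eq_bigr => a _; rewrite -mulrA mulr_suml mulr_sumr.
by apply: eq_bigr => b _; rewrite mulrA mulr_sumr.
Qed.

Lemma dot3C P Q : dot3 P Q = dot3 Q P.
Proof. by do 3![apply: eq_bigr => ? _]; rewrite mulrC. Qed.

Lemma dot3P a P Q u : dot3 (a *: P + Q) u = a * dot3 P u + dot3 Q u.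
Proof.
rewrite /dot3 !sum3_pair mulr_sumr -big_split.
by apply: eq_bigr => p _ /=; rewrite cptP mulrDl mulrA.
Qed.

Lemma dot3_move h P Q :
  dot3 P (move_indices h Q) = dot3 (move_indices h^T P) Q.
Proof.
rewrite /dot3 !sum3_pair.
under eq_bigr do rewrite cpt_mkT sum3_pair mulr_sumr.
rewrite exchange_big; apply: eq_bigr => q _ /=.
rewrite cpt_mkT sum3_pair mulr_suml; apply: eq_bigr => p _.
by rewrite !mxE; ring.
Qed.

Lemma move_indicesM g h Q :
  move_indices g (move_indices h Q) = move_indices (g *m h) Q.
Proof.
apply: tensor3P => r m n; rewrite !cpt_mkT !sum3_pair.
under eq_bigr do rewrite cpt_mkT sum3_pair mulr_sumr.
rewrite exchange_big; apply: eq_bigr => q _ /=.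
rewrite !mxE -sum3_prod sum3_pair mulr_suml; apply: eq_bigr => p _.
by ring.
Qed.

Lemma sum_delta (I : finType) (F : I -> R) i :
  \sum_j (j == i)%:R * F j = F i.
Proof.
rewrite (bigD1 i) //= eqxx mul1r big1 ?addr0 // => j /negbTE ->.
by rewrite mul0r.
Qed.

Lemma move_indices1 Q : move_indices 1%:M Q = Q.
Proof.
apply: tensor3P => r m n; rewrite cpt_mkT sum3_pair.
rewrite -(sum_delta (fun p => cpt Q p.1.1 p.1.2 p.2) (r, m, n)).
apply: eq_bigr => -[[a b] c] _ /=; rewrite !mxE !xpair_eqE -!natrM !mulnb.
by rewrite (eq_sym r) (eq_sym m) (eq_sym n).
Qed.

Lemma move_indicesP h a P Q :
  move_indices h (a *: P + Q) = a *: move_indices h P + move_indices h Q.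
Proof.
apply: tensor3P => r m n; rewrite cptP !cpt_mkT !sum3_pair mulr_sumr -big_split.
by apply: eq_bigr => p _ /=; rewrite cptP; ring.
Qed.

Lemma move_indicesD h P Q :
  move_indices h (P + Q) = move_indices h P + move_indices h Q.
Proof. by rewrite -[P in LHS]scale1r move_indicesP scale1r. Qed.

Lemma move_indices0 h : move_indices h 0 = 0.
Proof. by apply: (@addrI _ (move_indices h 0)); rewrite -move_indicesD !addr0. Qed.

Lemma move_indicesZ h a Q : move_indices h (a *: Q) = a *: move_indices h Q.
Proof. by rewrite -[a *: Q]addr0 move_indicesP move_indices0 addr0. Qed.

Lemma cycP a P Q : cyc (a *: P + Q) = a *: cyc P + cyc Q.
Proof. by apply: tensor3P => r m n; rewrite cptP !cpt_mkT cptP. Qed.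

Lemma move_cyc h Q : move_indices h (cyc Q) = cyc (move_indices h Q).
Proof.
apply: tensor3P => r m n; rewrite !cpt_mkT.
under eq_bigr do under eq_bigr do under eq_bigr do rewrite cpt_mkT.
rewrite exchange_big /=; under eq_bigr do rewrite exchange_big.
by do 3![apply: eq_bigr => ? _]; ring.
Qed.

Lemma move_sym h Q : Q \in symV R -> move_indices h Q \in symV R.
Proof.
move=> /symVP symQ; apply/symVP => r m n; rewrite !cpt_mkT.
apply: eq_bigr => a _; rewrite exchange_big /=.
by do 2![apply: eq_bigr => ? _]; rewrite symQ; ring.
Qed.

(** The adjoint of a cyclic shift is the inverse shift; symmetry of both arguments in their last two
    indices turns it back into the shift itself. *)
Lemma dot3_cyc u v : u \in symV R -> v \in symV R ->
  dot3 u (cyc v) = dot3 (cyc u) v.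
Proof.
move=> /symVP symu /symVP symv; rewrite /dot3.
rewrite exchange_big; apply: eq_bigr => b _; apply: eq_bigr => a _.
by apply: eq_bigr => c _ /=; rewrite !cpt_mkT symu symv.
Qed.

End Tensors.

(** * Traces and the operators B and C *)

Section Operators.
Variable R : realType.
Variable g : 'M[R]_4.
Hypothesis symg : g^T = g.
Hypothesis unitg : g \in unitmx.
Implicit Types (P Q u v : tensor3 R) (x y : 'rV[R]_4).

Let h := invmx g.

Lemma metricC r m : g r m = g m r.
Proof. by rewrite -[in LHS]symg mxE. Qed.

Lemma invmx_sym : h^T = h.
Proof. by rewrite /h trmx_inv symg. Qed.

Lemma inv_metricC r m : h r m = h m r.
Proof. by rewrite -[in LHS]invmx_sym mxE. Qed.

Lemma inv_metricK m r : \sum_n h m n * g n r = (m == r)%:R.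
Proof. by have /matrixP/(_ m r) := mulVmx unitg; rewrite !mxE. Qed.

Lemma inv_metric_metric : \sum_m \sum_n h m n * g m n = 4.
Proof.
under eq_bigr => m _ do under eq_bigr => n _ do rewrite metricC.
under eq_bigr => m _ do rewrite inv_metricK eqxx.
by rewrite sumr_const card_ord.
Qed.

Lemma raise3K Q : lower3 g (raise3 g Q) = Q.
Proof. by rewrite /lower3 /raise3 move_indicesM mulmxV// move_indices1. Qed.

Lemma lower3K Q : raise3 g (lower3 g Q) = Q.
Proof. by rewrite /lower3 /raise3 move_indicesM mulVmx// move_indices1. Qed.

Lemma pairingE P Q : pairing g P Q = dot3 P (raise3 g Q).
Proof. by []. Qed.

Lemma pairingEl P Q : pairing g P Q = dot3 (raise3 g P) Q.
Proof. by rewrite pairingE dot3_move invmx_sym. Qed.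

Lemma pairingC P Q : pairing g P Q = pairing g Q P.
Proof. by rewrite pairingE pairingEl dot3C. Qed.

Lemma pairingP a P Q u :
  pairing g (a *: P + Q) u = a * pairing g P u + pairing g Q u.
Proof. exact: dot3P. Qed.

Lemma vpairingE x y : vpairing g x y = (x *m h *m y^T) 0 0.
Proof.
rewrite /vpairing mxE exchange_big; apply: eq_bigr => n _.
by rewrite !mxE mulr_suml; apply: eq_bigr => m _; ring.
Qed.

Lemma vpairingC x y : vpairing g x y = vpairing g y x.
Proof.
rewrite !vpairingE; transitivity ((x *m h *m y^T)^T 0 0); first by rewrite [RHS]mxE.
by rewrite !trmx_mul trmxK invmx_sym mulmxA.
Qed.

Lemma vpairingP a x y z :
  vpairing g (a *: x + y) z = a * vpairing g x z + vpairing g y z.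
Proof. by rewrite !vpairingE !mulmxDl -!scalemxAl !mxE. Qed.

(** Trace parts built from a covector. With the identity and [sig] they make up [opB] and [opC], so
    the traces of these few pieces determine those of both operators. *)
Definition pure1 x : tensor3 R := mkT (fun r m n => x 0 r * g m n).
Definition pure2 x : tensor3 R :=
  mkT (fun r m n => g r m * x 0 n + g r n * x 0 m).
Definition sig Q : tensor3 R := mkT (fun r m n => cpt Q m n r + cpt Q n m r).

Lemma opBE Q :
  opB g Q = (- (1 / 2)) *: Q + ((1 / 2) *: sig Q +
    ((1 / 2) *: pure1 (tr1 g Q - tr2 g Q) + (- (1 / 4)) *: pure2 (tr1 g Q))).
Proof.
apply: tensor3P => r m n; rewrite !(cptD, cptZ) !cpt_mkT !mxE.
by rewrite -!mulrA; ring.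
Qed.

Lemma opCE P :
  opC g P = sig P +
    ((1 / 3) *: pure1 (tr1 g P - 2 *: tr2 g P) +
     (- (1 / 3)) *: pure2 (tr1 g P + tr2 g P)).
Proof.
apply: tensor3P => r m n; rewrite !(cptD, cptZ) !cpt_mkT !mxE.
by ring.
Qed.

Lemma tr1D P Q : tr1 g (P + Q) = tr1 g P + tr1 g Q.
Proof. by rewrite -[P]scale1r tr1P !scale1r. Qed.

Lemma tr2D P Q : tr2 g (P + Q) = tr2 g P + tr2 g Q.
Proof. by rewrite -[P]scale1r tr2P !scale1r. Qed.

Lemma tr10 : tr1 g 0 = 0.
Proof. by apply/(@addrI _ (tr1 g 0)); rewrite -tr1D !addr0. Qed.

Lemma tr20 : tr2 g 0 = 0.
Proof. by apply/(@addrI _ (tr2 g 0)); rewrite -tr2D !addr0. Qed.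

Lemma tr1Z a Q : tr1 g (a *: Q) = a *: tr1 g Q.
Proof. by rewrite -[X in tr1 g X]addr0 tr1P tr10 addr0. Qed.

Lemma tr2Z a Q : tr2 g (a *: Q) = a *: tr2 g Q.
Proof. by rewrite -[X in tr2 g X]addr0 tr2P tr20 addr0. Qed.

Lemma contract_metric x r : \sum_m \sum_n h m n * (g n r * x 0 m) = x 0 r.
Proof.
rewrite -[RHS](sum_delta (fun l => x 0 l)); apply: eq_bigr => m _.
by rewrite -inv_metricK mulr_suml; apply: eq_bigr => n _; rewrite mulrA.
Qed.

Lemma contract_metric' x r : \sum_m \sum_n h m n * (g m r * x 0 n) = x 0 r.
Proof.
rewrite exchange_big -[RHS]contract_metric.
by do 2![apply: eq_bigr => ? _]; rewrite inv_metricC.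
Qed.

Lemma contract_metric_full a : \sum_m \sum_n h m n * (g m n * a) = 4 * a.
Proof.
rewrite -inv_metric_metric mulr_suml.
by apply: eq_bigr => m _; rewrite mulr_suml; apply: eq_bigr => n _; rewrite mulrA.
Qed.

Lemma sum2D (F G : 'I_4 -> 'I_4 -> R) :
  \sum_m \sum_n (F m n + G m n) = \sum_m \sum_n F m n + \sum_m \sum_n G m n.
Proof. by rewrite -big_split; apply: eq_bigr => m _; rewrite big_split. Qed.

Lemma tr1_pure1 x : tr1 g (pure1 x) = 4 *: x.
Proof.
apply/rowP => r; rewrite !mxE -contract_metric_full.
by do 2![apply: eq_bigr => ? _]; rewrite cpt_mkT [x _ _ * _]mulrC.
Qed.

Lemma tr2_pure1 x : tr2 g (pure1 x) = x.
Proof.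
apply/rowP => r; rewrite !mxE -[RHS]contract_metric.
by do 2![apply: eq_bigr => ? _]; rewrite cpt_mkT (metricC r) [x _ _ * _]mulrC.
Qed.

Lemma tr1_pure2 x : tr1 g (pure2 x) = 2 *: x.
Proof.
apply/rowP => r; rewrite !mxE mulr_natl mulr2n.
rewrite -[X in X + _]contract_metric' -[X in _ = _ + X]contract_metric -sum2D.
apply: eq_bigr => m _; apply: eq_bigr => n _.
by rewrite cpt_mkT mulrDr !(metricC r).
Qed.

Lemma tr2_pure2 x : tr2 g (pure2 x) = 5 *: x.
Proof.
(* [5 = 1 + 4]: one summand contracts to a Kronecker delta, the other to the dimension. *)
apply/rowP => r; rewrite !mxE -[5]/(1 + 4)%:R natrD mulrDl mul1r.
rewrite -[X in X + _]contract_metric' -contract_metric_full -sum2D.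
by do 2![apply: eq_bigr => ? _]; rewrite cpt_mkT mulrDr.
Qed.

Lemma tr1_sig Q : Q \in symV R -> tr1 g (sig Q) = 2 *: tr2 g Q.
Proof.
move=> /symVP symQ; apply/rowP => r; rewrite !mxE mulr_natl mulr2n.
rewrite [X in _ = X + _]exchange_big -sum2D.
apply: eq_bigr => m _; apply: eq_bigr => n _.
by rewrite cpt_mkT mulrDr (symQ m n) (symQ n m) (inv_metricC n m) addrC.
Qed.

Lemma tr2_sig Q : Q \in symV R -> tr2 g (sig Q) = tr1 g Q + tr2 g Q.
Proof.
move=> /symVP symQ; apply/rowP => r; rewrite !mxE.
rewrite [X in _ = _ + X]exchange_big -sum2D.
apply: eq_bigr => m _; apply: eq_bigr => n _.
by rewrite cpt_mkT mulrDr (inv_metricC n m) (symQ r n).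
Qed.

Lemma tr1_opB Q : Q \in symV R -> tr1 g (opB g Q) = tr1 g Q - tr2 g Q.
Proof.
move=> VQ; rewrite opBE !(tr1D, tr1Z) tr1_sig // tr1_pure1 tr1_pure2.
by apply/rowP => r; rewrite !mxE; field.
Qed.

Lemma tr2_opB Q : Q \in symV R ->
  tr2 g (opB g Q) = (- (1 / 4)) *: tr1 g Q + (- (1 / 2)) *: tr2 g Q.
Proof.
move=> VQ; rewrite opBE !(tr2D, tr2Z) tr2_sig // tr2_pure1 tr2_pure2.
by apply/rowP => r; rewrite !mxE; field.
Qed.

Lemma tr1_opC P : P \in symV R ->
  tr1 g (opC g P) = (2 / 3) *: tr1 g P + (- (4 / 3)) *: tr2 g P.
Proof.
move=> VP; rewrite opCE !(tr1D, tr1Z) tr1_sig // tr1_pure1 tr1_pure2.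
by apply/rowP => r; rewrite !mxE; field.
Qed.

Lemma tr2_opC P : P \in symV R ->
  tr2 g (opC g P) = (- (1 / 3)) *: tr1 g P + (- (4 / 3)) *: tr2 g P.
Proof.
move=> VP; rewrite opCE !(tr2D, tr2Z) tr2_sig // tr2_pure1 tr2_pure2.
by apply/rowP => r; rewrite !mxE; field.
Qed.

Lemma opB_sym Q : Q \in symV R -> opB g Q \in symV R.
Proof.
by move=> /symVP symQ; apply/symVP => r m n; rewrite !cpt_mkT (metricC n m) (symQ r); ring.
Qed.

Lemma opC_sym P : P \in symV R -> opC g P \in symV R.
Proof.
by move=> /symVP symP; apply/symVP => r m n; rewrite !cpt_mkT (metricC n m); ring.
Qed.

Lemma opCK Q : Q \in symV R -> opC g (opB g Q) = Q.
Proof.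
move=> VQ; have /symVP symQ := VQ; apply: tensor3P => r m n.
rewrite cpt_mkT !cpt_mkT tr1_opB // tr2_opB // !mxE.
(* One representative per symmetric index pair, so that equal components become the same atom for
   [field]. *)
rewrite (symQ r n m) (symQ n r m) (symQ m r n) (metricC m r) (metricC n r) (metricC n m).
by field.
Qed.

Lemma opBK P : P \in symV R -> opB g (opC g P) = P.
Proof.
move=> VP; have /symVP symP := VP; apply: tensor3P => r m n.
rewrite cpt_mkT !cpt_mkT tr1_opC // tr2_opC // !mxE.
rewrite (symP r n m) (symP n r m) (symP m r n) (metricC m r) (metricC n r) (metricC n m).
by field.
Qed.

End Operators.

(** * The polar form of the quadratic form and its change of frame *)

Section PolarForm.
Variable R : realType.
Variable g : 'M[R]_4.
Implicit Types (P Q u v : tensor3 R) (x y : 'rV[R]_4).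

Let h := invmx g.

(** In general not symmetric, because of the mixed trace term. Adding the transpose gives [polar],
    the second derivative of [nonmet g]. *)
Definition bilin P Q : R :=
  - (1 / 4) * pairing g P Q + (1 / 2) * dot3 P (cyc (raise3 g Q))
  + (1 / 4) * vpairing g (tr1 g P) (tr1 g Q)
  - (1 / 2) * vpairing g (tr1 g P) (tr2 g Q).

Lemma nonmetE Q : nonmet g Q = bilin Q Q.
Proof.
rewrite /nonmet /bilin; congr (_ + _ * _ + _ - _).
by do 3![apply: eq_bigr => ? _]; rewrite [in RHS]cpt_mkT.
Qed.

Lemma bilinPl a P Q u : bilin (a *: P + Q) u = a * bilin P u + bilin Q u.
Proof. by rewrite /bilin pairingP dot3P !tr1P !vpairingP; ring. Qed.

Lemma vpairingPr a x y z :
  vpairing g z (a *: x + y) = a * vpairing g z x + vpairing g z y.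
Proof. by rewrite !vpairingE linearD linearZ mulmxDr -scalemxAr !mxE. Qed.

Lemma bilinPr a P Q u : bilin u (a *: P + Q) = a * bilin u P + bilin u Q.
Proof.
rewrite /bilin tr1P tr2P !vpairingPr !pairingE /raise3 move_indicesP cycP.
by rewrite ![dot3 u _]dot3C !dot3P ![dot3 _ u]dot3C; ring.
Qed.

Definition polar u v : R := bilin u v + bilin v u.

Lemma polarC u v : polar u v = polar v u.
Proof. by rewrite /polar addrC. Qed.

Lemma polarP a P Q u : polar (a *: P + Q) u = a * polar P u + polar Q u.
Proof. by rewrite /polar bilinPl bilinPr; ring. Qed.

Hypothesis symg : g^T = g.
Hypothesis unitg : g \in unitmx.

Lemma vpairing_sum x y : vpairing g x y = \sum_r (x *m h) 0 r * y 0 r.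
Proof. by rewrite vpairingE mxE; apply: eq_bigr => r _; rewrite [y^T _ _]mxE. Qed.

Lemma raise3_pure1 x :
  raise3 g (pure1 g x) = mkT (fun r m n => (x *m h) 0 r * h m n).
Proof.
apply: tensor3P => r m n; rewrite !cpt_mkT mxE mulr_suml.
apply: eq_bigr => a _.
(* Contracting over [c] first turns [h n c] and the metric factor into a Kronecker delta that fixes
   [b] to [n]. *)
transitivity (\sum_b (b == n)%:R * (x 0 a * h a r * h m b)).
  apply: eq_bigr => b _; rewrite eq_sym -(inv_metricK unitg) mulr_suml.
  apply: eq_bigr => c _.
  by rewrite cpt_mkT (metricC symg b) (inv_metricC symg a); ring.
by rewrite sum_delta.
Qed.

(** Adjointness of [pure1] and [tr1]. This and its cyclic versions turn the trace parts of [opB]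
    into the products of traces in the quadratic form. *)
Lemma pairing_pure1 x v : pairing g (pure1 g x) v = vpairing g x (tr1 g v).
Proof.
rewrite pairingEl // raise3_pure1 vpairing_sum; apply: eq_bigr => r _.
rewrite [tr1 _ _ _ _]mxE mulr_sumr; apply: eq_bigr => m _; rewrite mulr_sumr.
by apply: eq_bigr => n _; rewrite cpt_mkT mulrA.
Qed.

Lemma pure2E x : pure2 g x = cyc (cyc (pure1 g x)) + cyc (pure1 g x).
Proof.
apply: tensor3P => r m n; rewrite cptD !cpt_mkT (metricC symg n r).
by ring.
Qed.

Lemma pairingD P Q u : pairing g (P + Q) u = pairing g P u + pairing g Q u.
Proof. by rewrite -[P]scale1r pairingP scale1r mul1r. Qed.

Lemma pairing0 u : pairing g 0 u = 0.
Proof. by apply: (@addrI _ (pairing g 0 u)); rewrite -pairingD !addr0. Qed.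

Lemma pairingZ a P u : pairing g (a *: P) u = a * pairing g P u.
Proof. by rewrite -[X in pairing g X]addr0 pairingP pairing0 addr0. Qed.

(** The shift moves the free index of [pure1] to the middle and the metric to the outer two slots,
    the contraction pattern of [tr2]. *)
Lemma pairing_cyc_pure1 x v :
  pairing g (cyc (pure1 g x)) v = vpairing g x (tr2 g v).
Proof.
rewrite pairingEl // /raise3 move_cyc -/(raise3 g _).
rewrite raise3_pure1 vpairing_sum /dot3 exchange_big; apply: eq_bigr => m _.
rewrite [tr2 _ _ _ _]mxE mulr_sumr; apply: eq_bigr => r _; rewrite mulr_sumr.
by apply: eq_bigr => n _ /=; rewrite !cpt_mkT (inv_metricC symg r) mulrA.
Qed.

Lemma dot3_swap P v : v \in symV R ->
  dot3 (mkT (fun r m n => cpt P r n m)) v = dot3 P v.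
Proof.
move=> /symVP symv; apply: eq_bigr => r _; rewrite exchange_big.
by do 2![apply: eq_bigr => ? _]; rewrite cpt_mkT symv.
Qed.

Lemma pairing_cyc_cyc_pure1 x v : v \in symV R ->
  pairing g (cyc (cyc (pure1 g x))) v = vpairing g x (tr2 g v).
Proof.
move=> Vv; rewrite -pairing_cyc_pure1 // !pairingE -[RHS]dot3_swap ?move_sym //.
congr (dot3 _ _); apply: tensor3P => r m n.
by rewrite !cpt_mkT (metricC symg r m).
Qed.

(** The two halves of [sig u] differ by an exchange of the last two indices, which pairing with an
    element of [symV R] does not detect. *)
Lemma pairing_sig u v : u \in symV R -> v \in symV R ->
  pairing g (sig u) v = 2 * pairing g (cyc u) v.
Proof.
move=> Vu Vv; have -> : sig u = cyc u + mkT (fun r m n => cpt (cyc u) r n m).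
  by apply: tensor3P => r m n; rewrite cptD !cpt_mkT.
by rewrite pairingD !pairingE dot3_swap ?move_sym //; ring.
Qed.

(** Term by term: self-adjointness of [cyc] on [symV R] merges the two cyclic terms into the [sig]
    part, and the products of traces come from [pure1] and [pure2] by adjointness. *)
Lemma polar_opB u v : u \in symV R -> v \in symV R ->
  polar u v = pairing g (opB g u) v.
Proof.
move=> Vu Vv; rewrite opBE !(pairingD, pairingZ) pairing_sig // pure2E.
rewrite pairingD pairing_cyc_cyc_pure1 // pairing_cyc_pure1 // pairing_pure1.
have -> : tr1 g u - tr2 g u = (-1) *: tr2 g u + tr1 g u.
  by rewrite scaleN1r addrC.
rewrite vpairingP /polar /bilin.
rewrite dot3_cyc ?move_sym // /raise3 -move_cyc -!/(raise3 g _) -!pairingE.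
rewrite (pairingC symg v u) (pairingC symg v) (vpairingC symg (tr1 g v) (tr1 g u)).
rewrite (vpairingC symg (tr1 g v) (tr2 g u)).
by field.
Qed.

End PolarForm.

(** * Change of frame: the rows of [E] are the new basis vectors, [D] is the metric in them *)

Section Congruence.
Variable R : realType.
Variables g E : 'M[R]_4.
Hypothesis unitg : g \in unitmx.
Hypothesis unitE : E \in unitmx.
Implicit Types (P Q u v : tensor3 R) (x y : 'rV[R]_4).

Let D := E *m g *m E^T.

Lemma congr_unit : D \in unitmx.
Proof. by rewrite !unitmx_mul unitE unitg unitmx_tr. Qed.

Lemma congr_inv : E^T *m invmx D *m E = invmx g.
Proof.
rewrite -[LHS](mulmxK unitg) -[RHS]mul1mx; congr (_ *m _).
have uET : E^T \in unitmx by rewrite unitmx_tr.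
(* Multiplying by [E^T] on the right, after [g], completes a copy of [D] next to its inverse. *)
rewrite -[LHS](mulmxK uET) -!mulmxA [E *m (g *m _)]mulmxA.
rewrite [E *m g *m _]mulmxA -/D [invmx D *m _]mulmxA mulVmx ?congr_unit //.
by rewrite mul1mx mulmxV.
Qed.

Lemma dot3_congr P Q :
  dot3 (move_indices E P) (raise3 D (move_indices E Q)) = dot3 P (raise3 g Q).
Proof.
transitivity (dot3 P (move_indices E^T (raise3 D (move_indices E Q)))).
  by rewrite [RHS]dot3_move trmxK.
by rewrite /raise3 !move_indicesM congr_inv.
Qed.

(** Two of the three factors [E] are absorbed by [congr_inv]; the third acts on the remaining
    covector index. *)
Lemma tr1_congr Q : tr1 D (move_indices E Q) = tr1 g Q *m E^T.
Proof.
apply/rowP => r; rewrite !mxE.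
transitivity (\sum_a \sum_b \sum_c (E r a * invmx g b c * cpt Q a b c)).
  rewrite sum3_pair.
  under eq_bigr => m _ do under eq_bigr => n _ do
    rewrite cpt_mkT sum3_pair mulr_sumr.
  rewrite pair_bigA exchange_big; apply: eq_bigr => -[[a b] c] _ /=.
  rewrite -congr_inv mxE mulr_sumr mulr_suml.
  rewrite -(pair_bigA _ (fun m n => invmx D m n * (E r a * E m b * E n c * cpt Q a b c))) /=.
  rewrite exchange_big; apply: eq_bigr => n _; rewrite mxE mulr_suml mulr_sumr mulr_suml.
  by apply: eq_bigr => m _; rewrite !mxE; ring.
apply: eq_bigr => a _; rewrite !mxE mulr_suml; apply: eq_bigr => b _.
by rewrite mulr_suml; apply: eq_bigr => c _; ring.
Qed.

(** Carries the second trace to the first, so that the frame change is computed for [tr1] only. *)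
Definition swap12 Q : tensor3 R := mkT (fun r m n => cpt Q m r n).

Lemma move_swap12 Q : move_indices E (swap12 Q) = swap12 (move_indices E Q).
Proof.
apply: tensor3P => r m n; rewrite !cpt_mkT exchange_big /=.
by do 3![apply: eq_bigr => ? _]; rewrite cpt_mkT; ring.
Qed.

Lemma tr2_swap12 (k : 'M[R]_4) Q : tr2 k Q = tr1 k (swap12 Q).
Proof.
by apply/rowP => r; rewrite !mxE; do 2![apply: eq_bigr => ? _]; rewrite cpt_mkT.
Qed.

Lemma tr2_congr Q : tr2 D (move_indices E Q) = tr2 g Q *m E^T.
Proof. by rewrite !tr2_swap12 -move_swap12 tr1_congr. Qed.

Lemma vpairing_congr x y : vpairing D (x *m E^T) (y *m E^T) = vpairing g x y.
Proof. by rewrite !vpairingE trmx_mul trmxK -congr_inv !mulmxA. Qed.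

Lemma raise3_cyc (k : 'M[R]_4) Q : raise3 k (cyc Q) = cyc (raise3 k Q).
Proof. exact: move_cyc. Qed.

Lemma bilin_congr P Q :
  bilin D (move_indices E P) (move_indices E Q) = bilin g P Q.
Proof.
rewrite /bilin !pairingE dot3_congr !tr1_congr !tr2_congr !vpairing_congr.
by rewrite -!raise3_cyc -move_cyc dot3_congr.
Qed.

Lemma polar_congr P Q :
  polar D (move_indices E P) (move_indices E Q) = polar g P Q.
Proof. by rewrite /polar !bilin_congr. Qed.

End Congruence.

(** * Diagonal metrics *)

Section DiagonalMetric.
Variable R : realType.
Implicit Types (u v : tensor3 R) (w : 'I_4 -> R).

Definition i0 : 'I_4 := @Ordinal 4 0 isT.
Definition i1 : 'I_4 := @Ordinal 4 1 isT.
Definition i2 : 'I_4 := @Ordinal 4 2 isT.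
Definition i3 : 'I_4 := @Ordinal 4 3 isT.

Lemma big4 (S : Type) (idx : S) (op : Monoid.law idx) (F : 'I_4 -> S) :
  \big[op/idx]_i F i = op (F i0) (op (F i1) (op (F i2) (F i3))).
Proof.
rewrite !big_ord_recl big_ord0 Monoid.mulm1.
by congr (op (F _) (op (F _) (op (F _) (F _)))); apply: val_inj.
Qed.

Lemma ord4P (p : 'I_4 -> Prop) : p i0 -> p i1 -> p i2 -> p i3 -> forall i, p i.
Proof.
move=> p0 p1 p2 p3 [[|[|[|[|//]]]] lti].
- by rewrite (_ : Ordinal lti = i0) //; apply: val_inj.
- by rewrite (_ : Ordinal lti = i1) //; apply: val_inj.
- by rewrite (_ : Ordinal lti = i2) //; apply: val_inj.
- by rewrite (_ : Ordinal lti = i3) //; apply: val_inj.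
Qed.

Definition other (i : 'I_4) : 'I_4 * 'I_4 * 'I_4 :=
  match val i with
  | 0 => (i1, i2, i3)
  | 1 => (i0, i2, i3)
  | 2 => (i0, i1, i3)
  | _ => (i0, i1, i2)
  end.

(* Entries 0-6 belong to the components [u i i i], [u i j j], [u j i j] with
   [j != i], entries 7-9 to those whose indices are a permutation of [other i]. *)
Definition diag_coef w (i : 'I_4) : seq R :=
  let: (a, b, c) := other i in
  let p := w a * w b * w c in
  [:: w i; w i / 3; w i / 3; w i / 12; - (w i / 4); - (w i / 12); - (w i / 12);
      p / 3; - p; - (p / 3)].

(** On the 7-dimensional block the component part, divided by [w i], is the sum over [j] of
    [2 Z_j^2 - A_j^2 / 2] plus [X_i^2 / 2]: completing the square in [X_j] produces [A]. The
    zero-sum parts of [Z] and [A] are split by contrasts. With the trace terms the rest is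
    [x^2 / 3 - z t / 3], and the product is split by [z - t] and [z + t]. The permutation block is
    split into the sum of the [q]s and two contrasts. *)
Definition diag_coord w (u : 'I_4 -> 'I_4 -> 'I_4 -> R) (i : 'I_4) : seq R :=
  let: (a, b, c) := other i in
  let X j := w j * u i j j in
  let Z j := w j * u j i j in
  let A j := X j - 2 * Z j in
  let x := X a + X b + X c in
  let z := Z a + Z b + Z c in
  let t := x + 3 * X i in
  let q1 := u a b c in
  let q2 := u b a c in
  let q3 := u c a b in
  [:: Z a - Z b; Z a + Z b - 2 * Z c; x; z - t;
      A a - A b; A a + A b - 2 * A c; z + t;
      q1 + q2 + q3; q1 - q2; q1 + q2 - 2 * q3].

Lemma diag_identity w (u v : 'I_4 -> 'I_4 -> 'I_4 -> R) :
  (forall r m n, u r m n = u r n m) -> (forall r m n, v r m n = v r n m) ->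
  let T r := \sum_(m < 4) w m * u r m m in
  let T' r := \sum_(m < 4) w m * u m r m in
  let S r := \sum_(m < 4) w m * v r m m in
  let S' r := \sum_(m < 4) w m * v m r m in
  \sum_(r < 4) \sum_(m < 4) \sum_(n < 4) w r * w m * w n *
     (- (1 / 2) * (u r m n * v r m n)
      + (1 / 2) * (u r m n * v m n r + v r m n * u m n r))
  + \sum_(r < 4) w r * ((1 / 2) * (T r * S r) - (1 / 2) * (T r * S' r + S r * T' r)) =
  \sum_(i < 4) \sum_(k < 10)
     nth 0 (diag_coef w i) k * nth 0 (diag_coord w u i) k * nth 0 (diag_coord w v i) k.
Proof.
move=> su sv T T' S S'.
under [RHS]eq_bigr => i _ do rewrite !big_ord_recl big_ord0 /=.
rewrite /T /T' /S /S' {T T' S S'}.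
rewrite !big4 /=.
(* Ordering the last two indices leaves the 40 independent components of each tensor as atoms. *)
rewrite ?(su _ i1 i0, su _ i2 i0, su _ i3 i0, su _ i2 i1, su _ i3 i1, su _ i3 i2).
rewrite ?(sv _ i1 i0, sv _ i2 i0, sv _ i3 i0, sv _ i2 i1, sv _ i3 i1, sv _ i3 i2).
by field.
Qed.

Lemma move_diag (w : 'rV[R]_4) u r m n :
  cpt (move_indices (diag_mx w) u) r m n = w 0 r * w 0 m * w 0 n * cpt u r m n.
Proof.
rewrite cpt_mkT sum3_pair.
rewrite -(sum_delta (fun p => w 0 r * w 0 m * w 0 n * cpt u p.1.1 p.1.2 p.2) (r, m, n)).
apply: eq_bigr => -[[a b] c] _ /=; rewrite !mxE !xpair_eqE.
rewrite (eq_sym r) (eq_sym m) (eq_sym n).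
by case: (a == r); case: (b == m); case: (c == n); rewrite /= ?mulr1n ?mulr0n; ring.
Qed.

Lemma sum_diag (w : 'rV[R]_4) (F : 'I_4 -> 'I_4 -> R) :
  \sum_m \sum_n diag_mx w m n * F m n = \sum_m w 0 m * F m m.
Proof.
apply: eq_bigr => m _; rewrite -(sum_delta (fun n => w 0 m * F m n) m).
apply: eq_bigr => n _; rewrite !mxE (eq_sym m).
by case: (n == m); rewrite ?mulr1n ?mulr0n; ring.
Qed.

Lemma polar_diag (D : 'M[R]_4) (w : 'rV[R]_4) u v :
  D^T = D -> invmx D = diag_mx w -> u \in symV R -> v \in symV R ->
  polar D u v =
  \sum_(i < 4) \sum_(k < 10) nth 0 (diag_coef (w 0) i) k *
    nth 0 (diag_coord (w 0) (cpt u) i) k * nth 0 (diag_coord (w 0) (cpt v) i) k.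
Proof.
move=> symD Dw Vu Vv; rewrite -diag_identity; [|exact/symVP..].
have tr1E x r : tr1 D x 0 r = \sum_m w 0 m * cpt x r m m by rewrite mxE Dw sum_diag.
have tr2E x r : tr2 D x 0 r = \sum_m w 0 m * cpt x m r m.
  by rewrite mxE Dw (sum_diag _ (fun m n => cpt x m r n)).
have vpE x y : vpairing D x y = \sum_r w 0 r * (x 0 r * y 0 r).
  rewrite -(sum_diag _ (fun m n => x 0 m * y 0 n)) /vpairing Dw.
  by do 2![apply: eq_bigr => ? _]; rewrite mulrA.
under [X in _ = _ + X]eq_bigr => r _ do rewrite -!tr1E -!tr2E.
(* Separates the component part from the trace part, the two groups of terms in [diag_identity]. *)
transitivity
 (- (1 / 2) * pairing D u v
  + (1 / 2) * (dot3 u (cyc (raise3 D v)) + dot3 v (cyc (raise3 D u)))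
  + ((1 / 2) * vpairing D (tr1 D u) (tr1 D v)
  - (1 / 2) * (vpairing D (tr1 D u) (tr2 D v) + vpairing D (tr1 D v) (tr2 D u)))).
  rewrite /polar /bilin [pairing D v u]pairingC //.
  have -> : vpairing D (tr1 D v) (tr1 D u) = vpairing D (tr1 D u) (tr1 D v).
    by rewrite !vpE; apply: eq_bigr => r _; ring.
  by field.
congr (_ + _).
  rewrite pairingE /dot3 !sum3_pair mulr_sumr -big_split mulr_sumr -big_split.
  apply: eq_bigr => -[[r m] n] _ /=; rewrite /raise3 Dw.
  by rewrite !(cpt_mkT (fun r m n => cpt _ m n r)) !move_diag; ring.
rewrite !vpE -big_split !mulr_sumr -sumrB; apply: eq_bigr => r _ /=.
by ring.
Qed.

End DiagonalMetric.

(** * Inertia from coordinates *)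

Section LinearAlgebra.
Variables (R : realType) (vT : vectType R).
Implicit Types (U : {vspace vT}) (b : vT -> vT -> R).

Lemma dim_mx_space m n : \dim (fullv : {vspace 'M[R]_(m, n)}) = (m * n)%N.
Proof. by rewrite dimvf /dim /=. Qed.

Lemma cap_lker_eq0 U m n (l : {linear vT -> 'M[R]_(m, n)}) :
  (forall u, u \in U -> l u = 0 -> u = 0) -> (U :&: lker (linfun l))%VS = 0%VS.
Proof.
move=> injl; apply/eqP; rewrite -subv0; apply/subvP => u.
rewrite memv_cap memv_ker lfunE => /andP[Uu /eqP lu0].
by rewrite (injl u Uu lu0) mem0v.
Qed.

Lemma inj_limg_full U m n (l : {linear vT -> 'M[R]_(m, n)}) :
    \dim U = (m * n)%N -> (forall u, u \in U -> l u = 0 -> u = 0) ->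
  forall A, exists u, u \in U /\ l u = A.
Proof.
move=> dimU injl A.
have kerU := cap_lker_eq0 injl.
have imU : (linfun l @: U)%VS = fullv.
  by apply/eqP; rewrite eqEdim subvf limg_dim_eq //= dim_mx_space dimU.
have : A \in (linfun l @: U)%VS by rewrite imU memvf.
by case/memv_imgP => u Uu ->; exists u; rewrite lfunE.
Qed.

Lemma dim_coord U m n (l : {linear vT -> 'M[R]_(m, n)}) :
    (forall u, u \in U -> l u = 0 -> u = 0) ->
    (forall A, exists u, u \in U /\ l u = A) ->
  \dim U = (m * n)%N.
Proof.
move=> injl surl.
have kerU := cap_lker_eq0 injl.
rewrite -dim_mx_space -(limg_dim_eq kerU); congr (\dim _); apply/eqP.
rewrite eqEsubv subvf /=; apply/subvP => A _; have [u [Uu <-]] := surl A.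
by apply/memv_imgP; exists u; rewrite ?lfunE.
Qed.

Lemma tuple_of_family (I : finType) (e : I -> vT) d : d = #|I| ->
  exists (t : d.-tuple vT) (f : 'I_d -> I), bijective f /\ forall i, tnth t i = e (f i).
Proof.
move=> ->; exists [tuple e (enum_val i) | i < #|I|], enum_val.
by split=> [|i]; [exact: enum_val_bij | rewrite tnth_mktuple].
Qed.

(** The preimages under [l] of the matrix units form an orthogonal basis of [U] on which [b] takes
    the values [c i k]. *)
Lemma diag_inertia U b m n (l : {linear vT -> 'M[R]_(m, n)})
    (c : 'I_m -> 'I_n -> R) :
    sym_bilinear_on U b -> \dim U = (m * n)%N ->
    (forall u, u \in U -> l u = 0 -> u = 0) ->
    {in U &, forall u v, b u v = \sum_i \sum_k c i k * l u i k * l v i k} ->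
  has_inertia U b #|[set p | 0 < c p.1 p.2]| #|[set p | c p.1 p.2 < 0]|.
Proof.
move=> bsym dimU injl bE; split=> //.
have /choice[e eP] : forall p : 'I_m * 'I_n,
    exists u, u \in U /\ l u = delta_mx p.1 p.2.
  by move=> p; apply: inj_limg_full.
have be p q : b (e p) (e q) = (q == p)%:R * c p.1 p.2.
  have [Up lp] := eP p; have [Uq lq] := eP q.
  rewrite bE // pair_bigA /= lp lq (bigD1 p) //= big1 ?addr0 => [|s].
    by rewrite !mxE !eqxx mulr1 mulrC (eq_sym q) -pair_eqE.
  rewrite !mxE -pair_eqE /pair_eq => /negbTE -> .
  by rewrite mulr0 mul0r.
have [|t [f [bij_f tf]]] := @tuple_of_family _ e (\dim U).
  by rewrite dimU card_prod !card_ord.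
have inj_f := bij_inj bij_f.
exists t; split.
- rewrite basisEdim size_tuple leqnn andbT; apply/subvP => u Uu.
  (* There are [\dim U] vectors, so spanning suffices; the difference of the two sides is killed by
     the injective [l]. *)
  suff -> : u = \sum_p l u p.1 p.2 *: e p.
    apply: memv_suml => p _; apply: memvZ; apply: memv_span.
    by have [f' _ f'K] := bij_f; rewrite -[p]f'K -tf mem_tnth.
  apply/eqP; rewrite -subr_eq0; apply/eqP/injl.
    by rewrite memvB // memv_suml // => p _; rewrite memvZ //; case: (eP p).
  rewrite linearB linear_sum /= {1}[l u]matrix_sum_delta pair_bigA /= -sumrB.
  by apply: big1 => p _; rewrite linearZ /= (eP p).2 subrr.
- by move=> i j ij; rewrite !tf be (inj_eq inj_f) eq_sym (negbTE ij) mul0r.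
- transitivity #|f @^-1: [set p | 0 < c p.1 p.2]|; last exact/on_card_preimset/onW_bij.
  by apply: eq_card => i; rewrite !inE !tf be eqxx mul1r.
- transitivity #|f @^-1: [set p | c p.1 p.2 < 0]|; last exact/on_card_preimset/onW_bij.
  by apply: eq_card => i; rewrite !inE !tf be eqxx mul1r.
Qed.

Lemma eq_inertia U b b' p n :
  {in U &, b =2 b'} -> has_inertia U b p n -> has_inertia U b' p n.
Proof.
move=> bb' [[bC bP] [e [be eo ep en]]]; split.
  split=> [u v Uu Uv|a u v w Uu Uv Uw]; first by rewrite -!bb' // bC.
  by rewrite -!bb' ?bP // memvD // memvZ.
have Ue i : tnth e i \in U by apply: (basis_mem be); apply: mem_tnth.
exists e; split=> //.
- by move=> i j ij; rewrite -bb' // eo.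
- by rewrite -ep; apply: eq_card => i; rewrite !inE bb'.
- by rewrite -en; apply: eq_card => i; rewrite !inE bb'.
Qed.

Lemma neg_scale_inertia U b p n k : k < 0 ->
  has_inertia U b p n -> has_inertia U (fun u v => k * b u v) n p.
Proof.
move=> k0 [[bC bP] [e [be eo ep en]]]; split.
  split=> [u v Uu Uv|a u v w Uu Uv Uw]; first by rewrite bC.
  by rewrite bP //; ring.
exists e; split=> //.
- by move=> i j ij; rewrite eo // mulr0.
- by rewrite -en; apply: eq_card => i; rewrite !inE nmulr_rgt0.
- by rewrite -ep; apply: eq_card => i; rewrite !inE nmulr_rlt0.
Qed.

End LinearAlgebra.

(** * Orthogonal frames, sign counts and dimension *)

Section Counting.
Variable R : realType.

Lemma lorentzian_frame (g : 'M[R]_4) : lorentzian g ->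
  exists (E : 'M[R]_4) (d : 'rV[R]_4),
    [/\ E \in unitmx, E *m g *m E^T = diag_mx d,
        #|[set i | 0 < d 0 i]| = 3%N, #|[set i | d 0 i < 0]| = 1%N &
        \prod_i d 0 i < 0].
Proof.
(* The tuple [e] has a dimension as its length; generalizing that length allows it to be replaced by
   4. *)
case=> _ [_ [e []]]; have := dim_mx_space R 1 4; rewrite mul1n.
move: (\dim _) e => d e dE; subst d => /= e_basis e_orth pos3 neg1.
pose E := \matrix_(i < 4) tnth e i.
pose d := \row_(i < 4) (tnth e i *m g *m (tnth e i)^T) 0 0.
have EgE i j : (E *m g *m E^T) i j = (tnth e i *m g *m (tnth e j)^T) 0 0.
  rewrite -[tnth e i](rowK (tnth e)) -[tnth e j](rowK (tnth e)) -/E.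
  rewrite -row_mul mxE [RHS]mxE; apply: eq_bigr => k _.
  by rewrite [row i _ 0 k]mxE [_^T k 0]mxE [row j E 0 k]mxE [_^T k j]mxE.
exists E, d; split.
- rewrite unitmxE unitfE; apply/det0P => -[v v0 vE].
  have /freeP := basis_free e_basis => /(_ (v 0)) v_free.
  case/eqP: v0; apply/rowP => i; rewrite mxE; apply: v_free.
  rewrite -[RHS]vE mulmx_sum_row; apply: eq_bigr => j _.
  by rewrite rowK -tnth_nth.
- apply/matrixP => i j; rewrite EgE [diag_mx _ _ _]mxE.
  case: eqVneq => [->|ij]; first by rewrite mulr1n [d 0 j]mxE.
  by rewrite mulr0n; apply: e_orth.
- by rewrite -[RHS]pos3; apply: eq_card => i; rewrite !inE [d 0 i]mxE.
- by rewrite -[RHS]neg1; apply: eq_card => i; rewrite !inE [d 0 i]mxE.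
have posd : #|[set i | 0 < d 0 i]| = 3%N.
  by rewrite -[RHS]pos3; apply: eq_card => j; rewrite !inE [d 0 j]mxE.
have [a nega] : exists a, [set i | d 0 i < 0] = [set a].
  apply/cards1P/eqP; rewrite -[RHS]neg1.
  by apply: eq_card => i; rewrite !inE [d 0 i]mxE.
rewrite (bigD1 a) //= pmulr_llt0; last first.
  apply: prodr_gt0 => i ia; have : i \notin [set i | d 0 i < 0].
    by rewrite nega inE.
  rewrite inE -leNgt le_eqVlt => /orP[/eqP d0|//].
  (* A zero entry at [i] would leave only the two indices outside [[set a; i]] for the three
     positive entries. *)
  have /subset_leq_card : [set i | 0 < d 0 i] \subset ~: [set a; i].
    apply/fintype.subsetP => j; rewrite !inE; apply: contraTN => /orP[/eqP->|/eqP->].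
      by rewrite -leNgt ltW //; have := set11 a; rewrite -nega inE.
    by rewrite -d0 ltxx.
  have := cardsC [set a; i]; rewrite cards2 eq_sym ia card_ord posd.
  by rewrite -[4%N]/(2 + 2)%N => /addnI ->.
by have := set11 a; rewrite -nega inE.
Qed.

Lemma card_nth n (s : seq R) (P : pred R) : size s = n ->
  #|[set k : 'I_n | P (nth 0 s k)]| = count P s.
Proof.
move=> <-; rewrite -sum1_count (big_nth 0) big_mkord sum1dep_card.
by apply: eq_card => k; rewrite !inE.
Qed.

Lemma card_pairs (I J : finType) (P : I -> J -> bool) :
  #|[set p : I * J | P p.1 p.2]| = (\sum_i #|[set j | P i j]|)%N.
Proof.
rewrite -sum1dep_card -(pair_big_dep xpredT P (fun _ _ => 1%N)) /=.
by apply: eq_bigr => i _; rewrite sum1dep_card.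
Qed.

Lemma size_diag_coef (w : 'I_4 -> R) i : size (diag_coef w i) = 10%N.
Proof. by rewrite /diag_coef; case: (other i) => [[]]. Qed.

Lemma prod_other (w : 'I_4 -> R) i :
  \prod_j w j = w i * (w (other i).1.1 * w (other i).1.2 * w (other i).2).
Proof.
rewrite big4 /=; elim/ord4P: i; rewrite /other /=; ring.
Qed.

(** Only the signs of [w i] and of the product [p] of the other three weights matter, and they are
    opposite because [w i * p] is the negative total product. *)
Lemma count_diag_coef (w : 'I_4 -> R) i : \prod_j w j < 0 ->
  count (> 0) (diag_coef w i) = (if 0 < w i then 6%N else 4%N) /\
  count (< 0) (diag_coef w i) = (if 0 < w i then 4%N else 6%N).
Proof.
rewrite (prod_other w i) /diag_coef; case: (other i) => [[a b] c] /=.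
move: (w a * w b * w c) => p.
have [wi|wi|<-] := ltgtP 0 (w i); last by rewrite mul0r ltxx.
- rewrite pmulr_rlt0 // => p0.
  by rewrite !(oppr_gt0, oppr_lt0) !(pmulr_lgt0, pmulr_llt0) ?invr_gt0 //
    ?(lt_gtF wi, wi, lt_gtF p0, p0).
- rewrite nmulr_rlt0 // => p0.
  by rewrite !(oppr_gt0, oppr_lt0) !(pmulr_lgt0, pmulr_llt0) ?invr_gt0 //
    ?(lt_gtF wi, wi, lt_gtF p0, p0).
Qed.

Lemma card_diag_coef (w : 'I_4 -> R) : \prod_j w j < 0 -> #|[set i | 0 < w i]| = 3%N ->
  #|[set p : 'I_4 * 'I_10 | 0 < nth 0 (diag_coef w p.1) p.2]| = 22%N /\
  #|[set p : 'I_4 * 'I_10 | nth 0 (diag_coef w p.1) p.2 < 0]| = 18%N.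
Proof.
move=> prod_w pos3.
have sum_if x y : (\sum_i (if (0 < w i)%R then x else y))%N = (3 * x + y)%N.
  have neg1 : #|~: [set i | 0 < w i]| = 1%N.
    by have := cardsC [set i | 0 < w i]; rewrite pos3 card_ord -[4%N]/(3 + 1)%N => /addnI.
  rewrite (bigID (fun i => 0 < w i)) /=.
  under eq_bigr => i -> do [].
  under [X in (_ + X)%N]eq_bigr => i /negbTE -> do [].
  rewrite !sum_nat_const; congr (_ * _ + _)%N.
    by rewrite -[RHS]pos3; apply: eq_card => i; rewrite !inE.
  rewrite -[RHS]mul1n; congr (_ * _)%N; rewrite -[RHS]neg1.
  by apply: eq_card => i; rewrite !inE.
split.
- rewrite (card_pairs (fun i k => 0 < nth 0 (diag_coef w i) (k : 'I_10))).
  rewrite -[RHS]/(3 * 6 + 4)%N -sum_if; apply: eq_bigr => i _.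
  rewrite -(count_diag_coef i prod_w).1; apply: (card_nth (> 0)).
  exact: size_diag_coef.
- rewrite (card_pairs (fun i k => nth 0 (diag_coef w i) (k : 'I_10) < 0)).
  rewrite -[RHS]/(3 * 4 + 6)%N -sum_if; apply: eq_bigr => i _.
  rewrite -(count_diag_coef i prod_w).2; apply: (card_nth (< 0)).
  exact: size_diag_coef.
Qed.

End Counting.

(** * Dimension of the fibre *)

Section Dimension.
Variable R : realType.

Definition pair_of (k : 'I_10) : 'I_4 * 'I_4 :=
  nth (i0, i0) [:: (i0, i0); (i0, i1); (i1, i1); (i0, i2); (i1, i2); (i2, i2);
    (i0, i3); (i1, i3); (i2, i3); (i3, i3)] k.

(** Triangular enumeration of unordered pairs: ['C(M.+1, 2)] of them have maximum below [M]. *)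
Definition index_nat (m n : 'I_4) : nat := ('C((maxn m n).+1, 2) + minn m n)%N.

Lemma index_nat_lt m n : (index_nat m n < 10)%N.
Proof. by elim/ord4P: m; elim/ord4P: n. Qed.

Definition index_of (m n : 'I_4) : 'I_10 := Ordinal (index_nat_lt m n).

Lemma index_ofC m n : index_of m n = index_of n m.
Proof. by apply: val_inj; rewrite /= /index_nat maxnC minnC. Qed.

Lemma pair_ofK k : index_of (pair_of k).1 (pair_of k).2 = k.
Proof.
by apply: val_inj; case: k; do 10![case=> //].
Qed.

Lemma index_ofK m n :
  pair_of (index_of m n) = (m, n) \/ pair_of (index_of m n) = (n, m).
Proof.
elim/ord4P: m; elim/ord4P: n; first [by left | by right].
Qed.

Definition sym_coord (Q : tensor3 R) : 'M[R]_(4, 10) :=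
  \matrix_(r < 4, k < 10) cpt Q r (pair_of k).1 (pair_of k).2.

Fact sym_coord_is_linear : linear sym_coord.
Proof. by move=> a P Q; apply/matrixP => r k; rewrite !mxE cptP. Qed.
HB.instance Definition _ :=
  GRing.isLinear.Build R (tensor3 R) 'M[R]_(4, 10) *:%R sym_coord
    sym_coord_is_linear.

Lemma dim_symV : \dim (symV R) = 40%N.
Proof.
rewrite (@dim_coord _ _ _ 4 10 sym_coord) //.
  move=> Q /symVP symQ /matrixP Q0; apply: tensor3P => r m n.
  rewrite cpt0; have := Q0 r (index_of m n); rewrite !mxE.
  by case: (index_ofK m n) => -> //=; rewrite symQ.
move=> A; exists (mkT (fun r m n => A r (index_of m n))); split.
  by apply/symVP => r m n; rewrite !cpt_mkT index_ofC.
by apply/matrixP => r k; rewrite mxE cpt_mkT pair_ofK.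
Qed.

End Dimension.

(** * Derivatives of the Lagrangian *)

Section Hessian.
Variable R : realType.
Implicit Types (P Q u v : tensor3 R).

(** Off [t = 0] the difference quotient equals the affine function [a + t * c], whose limit is
    [a]. *)
Lemma derive_parabola (f : tensor3 R -> R) Q v a c :
  (forall t, f (t *: v + Q) = f Q + t * a + t ^+ 2 * c) -> 'D_v f Q = a.
Proof.
move=> fE; rewrite /derive; apply/cvg_lim => //.
apply: (@cvg_trans _ ((fun t : R => a + t * c) @ 0^')%classic).
  apply: near_eq_cvg; near=> t.
  have t0 : t != 0 by near: t; exact: nbhs_dnbhs_neq.
  by rewrite /= fE /GRing.scale /=; field.
suff : ((fun t : R => a + t * c) @ 0^' --> a + 0 * c)%classic.
  by rewrite mul0r addr0.
apply: cvgD; first exact: cvg_cst.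
by apply: cvgMl; apply: nbhs_dnbhs.
Unshelve. all: by end_near.
Qed.

Variables (g : 'M[R]_4).

Lemma derive_nonmet k Q v :
  'D_v (fun P => k * nonmet g P) Q = k * polar g Q v.
Proof.
apply: (@derive_parabola _ _ _ _ (k * bilin g v v)) => t.
by rewrite !nonmetE /polar !(bilinPl, bilinPr); ring.
Qed.

Lemma hessian_nonmet k Q u v :
  hessian (fun P => k * nonmet g P) Q u v = k * polar g u v.
Proof.
rewrite /hessian; under eq_fun do rewrite derive_nonmet.
(* The first derivative is linear in the base point, hence the quadratic coefficient 0 and a Hessian
   independent of [Q]. *)
by apply: (@derive_parabola _ _ _ _ 0) => t; rewrite polarP; ring.
Qed.

Lemma lagrangianE kappa :
  lagrangian g kappa = (fun P => coupling g kappa * nonmet g P).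
Proof.
by apply/funext => P; rewrite /lagrangian /coupling; congr (_ * _); ring.
Qed.

Lemma symunitC s a b : symunit R s a b = symunit R s b a.
Proof. by apply: tensor3P => r m n; rewrite !cpt_mkT; ring. Qed.

Lemma symunit_sym s a b : symunit R s a b \in symV R.
Proof. by apply/symVP => r m n; rewrite !cpt_mkT; ring. Qed.

Lemma symunit_tr s a b r m n :
  cpt (symunit R s a b) r m n = cpt (symunit R r m n) s a b.
Proof.
rewrite !cpt_mkT (eq_sym s r) (eq_sym a m) (eq_sym b n) (eq_sym a n) (eq_sym b m).
by ring.
Qed.

Lemma dot3_symunit Q s a b : Q \in symV R -> dot3 Q (symunit R s a b) = cpt Q s a b.
Proof.
move=> /symVP symQ.
transitivity (1 / 2 * (cpt Q s a b + cpt Q s b a)); last first.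
  by rewrite (symQ s b); field.
pose F (p : 'I_4 * 'I_4 * 'I_4) := cpt Q p.1.1 p.1.2 p.2.
rewrite -[cpt Q s a b](sum_delta F (s, a, b)) -[cpt Q s b a](sum_delta F (s, b, a)).
rewrite /dot3 sum3_pair -big_split mulr_sumr; apply: eq_bigr => -[[r m] n] _.
rewrite cpt_mkT /F /= !xpair_eqE.
by case: (r == s); case: (m == a); case: (n == b); case: (m == b); case: (n == a);
  rewrite /=; ring.
Qed.

(** On [symV R] the unrestricted sum of components times symmetrized units reproduces [Q]: by
    [symunit_tr] this is [dot3_symunit] with the two index groups exchanged. *)
Lemma sum_symunit (f : tensor3 R -> R) Q :
  (forall a P P', f (a *: P + P') = a * f P + f P') -> Q \in symV R ->
  \sum_(s < 4) \sum_(a < 4) \sum_(b < 4) f (symunit R s a b) * cpt Q s a b = f Q.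
Proof.
move=> fP VQ.
have f0 : f 0 = 0.
  apply: (@addrI _ (f 0)); rewrite addr0.
  by have := fP 1 0 0; rewrite scaler0 addr0 mul1r.
have fsum (I : finType) (c : I -> R) (e : I -> tensor3 R) :
    f (\sum_i c i *: e i) = \sum_i c i * f (e i).
  by elim/big_rec2: _ => [|i y x _ <-]; rewrite ?fP.
transitivity (f (\sum_(p : 'I_4 * 'I_4 * 'I_4)
    cpt Q p.1.1 p.1.2 p.2 *: symunit R p.1.1 p.1.2 p.2)).
  by rewrite fsum sum3_pair; apply: eq_bigr => p _; rewrite mulrC.
congr f; apply: tensor3P => r m n.
rewrite -(dot3_symunit _ _ _ VQ) /dot3 sum3_pair.
rewrite [LHS]/cpt summxE; apply: eq_bigr => p _.
by rewrite -symunit_tr mxE.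
Qed.

End Hessian.

(** * Lorentzian metrics *)

Section Frame.
Variable R : realType.
Implicit Types (g E : 'M[R]_4) (w : 'rV[R]_4) (P Q u v : tensor3 R).

Lemma lorentzian_diag g : lorentzian g ->
  exists (E : 'M[R]_4) (w : 'rV[R]_4),
    [/\ E \in unitmx, invmx (E *m g *m E^T) = diag_mx w,
        #|[set i | 0 < w 0 i]| = 3%N, \prod_i w 0 i < 0 & \det g < 0].
Proof.
move=> /lorentzian_frame[E [d [uE EgE pos3 _ prod_d]]].
pose w : 'rV[R]_4 := \row_i (d 0 i)^-1; exists E, w.
have detD : \det (E *m g *m E^T) = \prod_i d 0 i by rewrite EgE det_diag.
have detg : \det g < 0.
  (* The determinant changes by the positive factor [\det E ^+ 2], so it keeps its sign. *)
  move: prod_d; rewrite -detD !det_mulmx det_tr mulrAC -expr2 pmulr_rlt0 //.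
  by rewrite exprn_even_gt0 //= -unitfE -unitmxE.
split=> //.
- have uD : E *m g *m E^T \in unitmx.
    by rewrite unitmxE detD unitfE lt_eqF.
  suff DW : E *m g *m E^T *m diag_mx w = 1%:M by rewrite -[LHS]mulmx1 -DW mulKmx.
  rewrite EgE mulmx_diag; apply/matrixP => i j; rewrite !mxE; case: eqVneq => // ij.
  rewrite mulr1n mulfV //.
  by move: prod_d; apply: contraTneq => di0; rewrite (bigD1 i) //= di0 mul0r ltxx.
- by rewrite -[RHS]pos3; apply: eq_card => i; rewrite !inE mxE invr_gt0.
- by under eq_bigr do rewrite mxE; rewrite prodfV invr_lt0.
Qed.

Lemma det_lt0_unit g : \det g < 0 -> g \in unitmx.
Proof. by move=> detg; rewrite unitmxE unitfE lt_eqF. Qed.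

(** Testing against lowered symmetrized units recovers every component of [P]. *)
Lemma pairing_nondegenerate g P : g^T = g -> g \in unitmx -> P \in symV R ->
  (forall v, v \in symV R -> pairing g P v = 0) -> P = 0.
Proof.
move=> symg unitg VP P0; apply: tensor3P => r m n; rewrite cpt0.
rewrite -(dot3_symunit _ _ _ VP) -(lower3K unitg (symunit R r m n)).
by rewrite -pairingE P0 // move_sym // symunit_sym.
Qed.

Lemma polar_nondegenerate g u : g^T = g -> g \in unitmx -> u \in symV R ->
  (forall v, v \in symV R -> polar g u v = 0) -> u = 0.
Proof.
move=> symg unitg Vu u0; rewrite -(opCK symg unitg Vu).
rewrite (_ : opB g u = 0) ?linear0 //.
apply: (pairing_nondegenerate symg unitg); first exact: opB_sym.
by move=> v Vv; rewrite -polar_opB // u0.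
Qed.

(** * Inertia of the polar form *)

Definition frame_coord E w u : 'M[R]_(4, 10) :=
  \matrix_(i < 4, k < 10) nth 0 (diag_coord (w 0) (cpt (move_indices E u)) i) k.

Fact frame_coord_is_linear E w : linear (frame_coord E w).
Proof.
move=> a P Q; apply/matrixP => i k; rewrite !mxE /diag_coord move_indicesP.
case: (other i) => [[p q] r]; case: k => k ltk; rewrite !cptP.
by move: k ltk; do 10![case; first by move=> _ /=; ring].
Qed.
HB.instance Definition _ E w :=
  GRing.isLinear.Build R (tensor3 R) 'M[R]_(4, 10) *:%R (frame_coord E w)
    (frame_coord_is_linear E w).

Lemma polar_inertia g : lorentzian g -> has_inertia (symV R) (polar g) 22 18.
Proof.
move=> lor_g; have [symg _] := lor_g.
have [E [w [uE invD pos3 prod_w /det_lt0_unit unitg]]] := lorentzian_diag lor_g.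
have polarE u v : u \in symV R -> v \in symV R -> polar g u v =
    \sum_(i < 4) \sum_(k < 10)
      nth 0 (diag_coef (w 0) i) k * frame_coord E w u i k * frame_coord E w v i k.
  move=> Vu Vv; rewrite -(polar_congr unitg uE) (polar_diag _ invD) ?move_sym //.
    by do 2![apply: eq_bigr => ? _]; rewrite !mxE.
  by rewrite !trmx_mul trmxK symg mulmxA.
have [<- <-] := card_diag_coef prod_w pos3.
apply: (diag_inertia (l := frame_coord E w)
  (c := fun i (k : 'I_10) => nth 0 (diag_coef (w 0) i) k)) => //.
- by split=> [u v _ _|a u v x _ _ _]; [exact: polarC | exact: polarP].
- exact: dim_symV.
(* A tensor with vanishing coordinates lies in the radical of [polar g], so injectivity of the
   coordinates follows from nondegeneracy. *)
move=> u Vu u0; apply: (polar_nondegenerate symg unitg Vu) => v Vv.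
rewrite polarE // u0; apply: big1 => i _; apply: big1 => k _.
by rewrite mxE mulr0 mul0r.
Qed.

(** * Eigenvalues on the double-trace-free subspace *)

Lemma opB_V0 g Q : V0 g Q -> opB g Q = (- (1 / 2)) *: Q + (1 / 2) *: sig Q.
Proof.
case=> _ t1 t2; apply: tensor3P => r m n.
by rewrite cptD !cptZ !cpt_mkT t1 t2 !mxE; ring.
Qed.

Lemma opC_V0 g P : V0 g P -> opC g P = sig P.
Proof.
case=> _ t1 t2; apply: tensor3P => r m n.
by rewrite !cpt_mkT t1 t2 !mxE; ring.
Qed.

Lemma V0_opB g Q : g^T = g -> g \in unitmx -> V0 g Q -> V0 g (opB g Q).
Proof.
move=> symg unitg [VQ t1 t2]; split; first exact: opB_sym.
  by rewrite tr1_opB // t1 t2 subrr.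
by rewrite tr2_opB // t1 t2 !scaler0 addr0.
Qed.

Lemma sigE Q : Q \in symV R -> sig Q = cyc Q + cyc (cyc Q).
Proof.
move=> /symVP symQ; apply: tensor3P => r m n.
by rewrite cptD !cpt_mkT (symQ n m).
Qed.

Lemma sig_move h Q : Q \in symV R -> sig (move_indices h Q) = move_indices h (sig Q).
Proof.
by move=> VQ; rewrite !sigE ?move_sym // move_indicesD !move_cyc.
Qed.

(* Supported on the components with [r], [m], [n] a permutation of [0, 1, 2],
   where both traces vanish in an orthogonal frame. *)
Definition off_diag (f : 'I_4 -> R) : tensor3 R :=
  mkT (fun r m n => if uniq [:: r; m; n; i3] then f r else 0).

Lemma off_diag_sym f : off_diag f \in symV R.
Proof.
apply/symVP => r m n; rewrite !cpt_mkT; congr (if _ then _ else _).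
by rewrite /= !inE (eq_sym n m) !negb_or; do !case: eqP.
Qed.

(** Adding the identity to [sig] replaces each of the three values of [f] by their sum, so being an
    eigenvector amounts to three scalar equations. *)
Lemma sig_off_diag f s : f i0 + f i1 + f i2 = (s + 1) * f i0 ->
  f i0 + f i1 + f i2 = (s + 1) * f i1 -> f i0 + f i1 + f i2 = (s + 1) * f i2 ->
  sig (off_diag f) = s *: off_diag f.
Proof.
move=> f0 f1 f2; apply: tensor3P => r m n; rewrite cptZ !cpt_mkT.
elim/ord4P: r; elim/ord4P: m; elim/ord4P: n => /=; lra.
Qed.

Lemma opB_eigen g s f : lorentzian g -> f i0 != 0 ->
  sig (off_diag f) = s *: off_diag f ->
  exists Q, [/\ V0 g Q, Q <> 0 & opB g Q = ((s - 1) / 2) *: Q].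
Proof.
move=> lor_g f0 sigf; have [symg _] := lor_g.
have [E [w [uE invD _ _ /det_lt0_unit unitg]]] := lorentzian_diag lor_g.
(* The tensor whose components in the orthogonal frame are [off_diag f]. *)
pose Q := move_indices (invmx E) (off_diag f).
have EQ : move_indices E Q = off_diag f.
  by rewrite move_indicesM mulmxV // move_indices1.
have uET : E^T \in unitmx by rewrite unitmx_tr.
have VQ : Q \in symV R by rewrite move_sym // off_diag_sym.
have V0Q : V0 g Q.
  split=> //.
    rewrite -[LHS](mulmxK uET) -tr1_congr // EQ (_ : tr1 _ _ = 0) ?mul0mx //.
    apply/rowP => r; rewrite !mxE invD sum_diag; apply: big1 => m _.
    by rewrite cpt_mkT /= !inE eqxx /= andbF mulr0.
  rewrite -[LHS](mulmxK uET) -tr2_congr // EQ (_ : tr2 _ _ = 0) ?mul0mx //.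
  apply/rowP => r; rewrite !mxE invD (sum_diag _ (fun l n => cpt _ l r n)).
  by apply: big1 => m _; rewrite cpt_mkT /= !inE eqxx orbT /= mulr0.
exists Q; split=> // [Q0|].
  have /(congr1 (fun P : tensor3 R => cpt P i0 i1 i2)) := EQ.
  rewrite Q0 move_indices0.
  by rewrite cpt0 cpt_mkT /= => /esym/eqP; rewrite (negbTE f0).
have -> : opB g Q = (- (1 / 2)) *: Q + (1 / 2) *: sig Q by apply: opB_V0.
have -> : sig Q = s *: Q.
  by rewrite sig_move ?off_diag_sym // sigf move_indicesZ.
by rewrite scalerA -scalerDl; congr (_ *: _); field.
Qed.

Lemma opB_eigenvalue g a Q : g^T = g -> g \in unitmx -> V0 g Q -> Q <> 0 ->
  opB g Q = a *: Q -> a = 1 / 2 \/ a = - 1.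
Proof.
move=> symg unitg V0Q Q0 BQ; have [VQ _ _] := V0Q.
have sigQ : sig Q = (2 * a + 1) *: Q.
  apply: tensor3P => r m n.
  have := congr1 (fun P : tensor3 R => cpt P r m n) (opB_V0 V0Q).
  by rewrite BQ !(cptD, cptZ); lra.
(* On [V0 g] the operator [opC g] is [sig], so [C B = id] reads [a * (2 * a + 1) = 1]. *)
have := opCK symg unitg VQ; rewrite BQ linearZ /= opC_V0 // sigQ scalerA.
move/eqP; rewrite -[X in _ == X]scale1r -subr_eq0 -scalerBl scaler_eq0.
case/orP => [|/eqP //]; rewrite (_ : _ - 1 = (2 * a - 1) * (a + 1)); last by ring.
by rewrite mulf_eq0 => /orP[] /eqP a0; [left | right]; lra.
Qed.

(** * Action on the pair of traces *)

Definition trace_mixing : 'M[R]_(1 + 1) :=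
  block_mx 1%:M (- 1)%:M (- (1 / 4))%:M (- (1 / 2))%:M.

Lemma det_trace_mixing : \det trace_mixing = - (3 / 4).
Proof.
(* Elimination of the lower left entry; the pivot left over is [- 1 / 2 - 1 / 4]. *)
rewrite (_ : trace_mixing = block_mx 1%:M 0 (- (1 / 4))%:M 1%:M *m
  block_mx 1%:M (- 1)%:M 0 (- (3 / 4))%:M).
  by rewrite det_mulmx det_lblock det_ublock !det_scalar1; ring.
rewrite mulmx_block !mul0mx !mulmx0 !mul1mx !mulmx1 !addr0 /trace_mixing.
congr block_mx; rewrite -scalar_mxM -raddfD /=; congr (_%:M); by field.
Qed.

Lemma tr_opB g Q : g^T = g -> g \in unitmx -> Q \in symV R ->
  col_mx (tr1 g (opB g Q)) (tr2 g (opB g Q)) =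
  trace_mixing *m col_mx (tr1 g Q) (tr2 g Q).
Proof.
move=> symg unitg VQ; rewrite mul_block_col !mul_scalar_mx tr1_opB // tr2_opB //.
by rewrite scale1r scaleN1r.
Qed.

(** * Contractions with unrestricted indices *)

Lemma lower_upper_contraction g (A A' : {linear tensor3 R -> tensor3 R})
    r m n t c d : g^T = g -> g \in unitmx ->
  (forall Q, Q \in symV R -> A' Q \in symV R) ->
  (forall Q, Q \in symV R -> A (A' Q) = Q) ->
  \sum_(s < 4) \sum_(a < 4) \sum_(b < 4)
    lower_cpt g A r m n s a b * upper_cpt g A' s a b t c d =
  cpt (symunit R t c d) r m n.
Proof.
move=> symg unitg VA' AA'; set Y := A' (symunit R t c d).
pose F : tensor3 R := mkT (fun s a b => cpt (A (symunit R s a b)) r m n).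
transitivity (dot3 (lower3 g F) (raise3 g Y)); first by [].
(* Lowering is self-adjoint for a symmetric metric, so it can be moved onto the raised factor, where
   it cancels. *)
rewrite dot3C dot3_move symg -/(lower3 g _) raise3K // dot3C.
rewrite -[in RHS](AA' _ (symunit_sym R t c d)) -/Y.
rewrite -(sum_symunit (f := fun Q => cpt (A Q) r m n)).
- by do 3![apply: eq_bigr => ? _]; rewrite cpt_mkT.
- by move=> a P Q; rewrite linearP cptP.
by apply: VA'; apply: symunit_sym.
Qed.

(** Here the lowered group is a free one: by adjointness [lower_cpt] is a component of [A] applied
    to the lowered unit [X]. Summation then applies [A'] to [A X], and the final raising undoes the
    lowering. *)
Lemma upper_lower_contraction g (A A' : {linear tensor3 R -> tensor3 R})
    r m n t c d : g^T = g -> g \in unitmx ->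
  (forall Q, Q \in symV R -> A Q \in symV R) ->
  (forall Q, Q \in symV R -> A' (A Q) = Q) ->
  \sum_(s < 4) \sum_(a < 4) \sum_(b < 4)
    upper_cpt g A' r m n s a b * lower_cpt g A s a b t c d =
  cpt (symunit R t c d) r m n.
Proof.
move=> symg unitg VA A'A; pose X := lower3 g (symunit R t c d).
have VX : X \in symV R by rewrite move_sym // symunit_sym.
have lowerE s a b : lower_cpt g A s a b t c d = cpt (A X) s a b.
  pose F : tensor3 R := mkT (fun s' a' b' => cpt (A (symunit R s' a' b')) s a b).
  have VF : F \in symV R by apply/symVP => p q q'; rewrite !cpt_mkT symunitC.
  rewrite /lower_cpt -/F -dot3_symunit ?move_sym // -[g in LHS]symg -dot3_move.
  rewrite -(sum_symunit (f := fun Q => cpt (A Q) s a b)) //.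
    by do 3![apply: eq_bigr => ? _]; rewrite cpt_mkT.
  by move=> k P Q; rewrite linearP cptP.
under eq_bigr do under eq_bigr do under eq_bigr do rewrite lowerE.
rewrite (sum_symunit (f := fun Q => cpt (raise3 g (A' Q)) r m n)) ?VA //.
  by rewrite A'A // lower3K.
by move=> k P Q; rewrite linearP /raise3 move_indicesP cptP.
Qed.

Lemma coupling_lt0 g kappa : \det g < 0 -> 0 < kappa ^+ 2 -> coupling g kappa < 0.
Proof.
move=> detg kappa0; rewrite /coupling pmulr_llt0 ?invr_gt0 //.
by rewrite mulNr oppr_lt0 mulr_gt0 // sqrtr_gt0 oppr_gt0.
Qed.

(** The derivative along [symunit] is the pairing of [opB g Q] with it, which reads off one
    component of the raised tensor. *)
Lemma momentum_opB g kappa Q : g^T = g -> g \in unitmx -> Q \in symV R ->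
  lower3 g (momentum g kappa Q) = coupling g kappa *: opB g Q.
Proof.
move=> symg unitg VQ; rewrite -[RHS](raise3K unitg); congr (lower3 g _).
apply: tensor3P => r m n; rewrite [LHS]cpt_mkT lagrangianE derive_nonmet.
have VB := opB_sym symg VQ.
rewrite polar_opB ?symunit_sym // -pairingZ pairingEl //.
by rewrite dot3_symunit // move_sym // memvZ.
Qed.

End Frame.

Theorem theorem1 (R : realType) (g : 'M[R]_4) (kappa : R)
    (hg : lorentzian g) (hkappa : 0 < kappa ^+ 2) :
  let V := symV R in
  let k := coupling g kappa in
  let B := opB g in
  let C := opC g in
  let M := fun Q : tensor3 R => k *: B Q in
  let Minv := fun P : tensor3 R => k^-1 *: C P in
  let L := lagrangian g kappa in
  let Pi := fun Q : tensor3 R => lower3 g (momentum g kappa Q) in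
  (* setting: dimension of the fibre, endomorphisms, momentum map *)
  [/\ \dim V = 40%N,
      (forall Q, Q \in V -> B Q \in V),
      (forall P, P \in V -> C P \in V) &
      (forall Q, Q \in V -> Pi Q = M Q)] /\
  (* (i) *)
  [/\ (forall Q, Q \in V -> C (B Q) = Q),
      (forall P, P \in V -> B (C P) = P) &
      (forall Q P, Q \in V -> P \in V -> (Pi Q = P <-> Q = Minv P))] /\
  (* (ii) *)
  [/\ (forall Q, V0 g Q -> V0 g (B Q)),
      (forall a : R,
         (exists Q, [/\ V0 g Q, Q <> 0 & B Q = a *: Q]) <->
         a = 1 / 2 \/ a = - 1) &
      (exists T : 'M[R]_(1 + 1),
         (forall Q, Q \in V ->
            col_mx (tr1 g (B Q)) (tr2 g (B Q)) =
              T *m col_mx (tr1 g Q) (tr2 g Q)) /\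
         \det T = - (3 / 4))] /\
  (* (iii) *)
  ((forall Q u, Q \in V -> u \in V ->
      (forall v, v \in V -> hessian L Q u v = 0) -> u = 0) /\
   (forall P, P \in V -> exists! Q, Q \in V /\ Pi Q = P)) /\
  (* (iv) *)
  [/\ (forall Q, Q \in V -> has_inertia V (hessian (nonmet g) Q) 22 18),
      (forall Q u v, Q \in V -> u \in V -> v \in V ->
         hessian L Q u v = pairing g (M u) v) &
      has_inertia V (fun u v => pairing g (M u) v) 18 22] /\
  (* (v) *)
  ((forall r m n t c d : 'I_4,
      \sum_(s < 4) \sum_(a < 4) \sum_(b < 4)
        lower_cpt g M r m n s a b * upper_cpt g Minv s a b t c d =
      (r == t)%:R *
        (1 / 2 * ((m == c)%:R * (n == d)%:R + (n == c)%:R * (m == d)%:R))) /\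
   (forall r m n t c d : 'I_4,
      \sum_(s < 4) \sum_(a < 4) \sum_(b < 4)
        upper_cpt g Minv r m n s a b * lower_cpt g M s a b t c d =
      (r == t)%:R *
        (1 / 2 * ((m == c)%:R * (n == d)%:R + (n == c)%:R * (m == d)%:R)))).
Proof.
move=> V k B C M Minv L Pi; have [symg _] := hg.
have [E [w [_ _ _ _ detg]]] := lorentzian_diag hg.
have unitg := det_lt0_unit detg.
have k_lt0 : k < 0 by apply: coupling_lt0.
have k0 : k != 0 by rewrite lt_eqF.
have VB Q : Q \in V -> B Q \in V by exact: opB_sym.
have VC P : P \in V -> C P \in V by exact: opC_sym.
have CB Q : Q \in V -> C (B Q) = Q by exact: opCK.
have BC P : P \in V -> B (C P) = P by exact: opBK.
have PiM Q : Q \in V -> Pi Q = M Q by exact: momentum_opB.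
have MMinv P : P \in V -> M (Minv P) = P.
  by move=> VP; rewrite /M /Minv [B _]linearZ /= scalerA mulfV // scale1r; apply: BC.
have MinvM Q : Q \in V -> Minv (M Q) = Q.
  by move=> VQ; rewrite /M /Minv [C _]linearZ /= scalerA mulVf // scale1r; apply: CB.
have VMinv P : P \in V -> Minv P \in V by move=> VP; rewrite memvZ ?VC.
have PiP Q P : Q \in V -> P \in V -> (Pi Q = P <-> Q = Minv P).
  move=> VQ VP; rewrite PiM //.
  by split=> [<-|->]; [rewrite MinvM | rewrite MMinv].
have hessL Q u v : u \in V -> v \in V -> hessian L Q u v = pairing g (M u) v.
  move=> Vu Vv; rewrite /L lagrangianE hessian_nonmet polar_opB //.
  by rewrite -pairingZ.
split; first by split=> //; exact: dim_symV.
split; first by split.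
split; [split | split; [split | split; [split | split]]].
- by move=> Q; apply: V0_opB.
- move=> a; split=> [[Q [V0Q Q0 BQ]]|]; first exact: opB_eigenvalue BQ.
  case=> ->.
    (* Three equal values have sum [3 = s + 1], which gives the eigenvalue [(2 - 1) / 2]. *)
    have [|Q [V0Q Q0 BQ]] := opB_eigen (s := 2) (f := fun=> 1) hg (oner_neq0 R).
      by apply: sig_off_diag; ring.
    by exists Q; split=> //; rewrite [LHS]BQ; congr (_ *: _); field.
  (* The values 1, -1, 0 sum to zero, whence [s = -1] and the eigenvalue -1; the 0 is the default of
     [nth]. *)
  pose f (i : 'I_4) : R := nth 0 [:: 1; - 1] i.
  have [|Q [V0Q Q0 BQ]] := opB_eigen (s := -1) (f := f) hg (oner_neq0 R).
    by apply: sig_off_diag; rewrite /f /=; ring.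
  by exists Q; split=> //; rewrite [LHS]BQ; congr (_ *: _); field.
- exists (trace_mixing R); split; last exact: det_trace_mixing.
  by move=> Q; apply: tr_opB.
(* It suffices that [M u = 0], since [Minv] inverts [M]; [M u] pairs to zero with all of [V]. *)
- move=> Q u VQ Vu u0; rewrite -(MinvM u Vu) (_ : M u = 0) /Minv ?[C 0]linear0 ?scaler0 //.
  apply: (pairing_nondegenerate symg unitg); first by rewrite memvZ ?VB.
  by move=> v Vv; rewrite -(hessL Q) // u0.
- move=> P VP; exists (Minv P); split=> [|Q [VQ /PiP <-//]].
  by split; [exact: VMinv | apply/PiP => //; exact: VMinv].
- move=> Q VQ; apply: eq_inertia (polar_inertia hg) => u v Vu Vv.
  transitivity (hessian (fun P => 1 * nonmet g P) Q u v).
    by rewrite hessian_nonmet mul1r.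
  congr (hessian _ Q u v).
  by apply/funext => P; rewrite mul1r.
- by move=> Q u v _; apply: hessL.
(* The coupling [k] is negative, so the two counts are exchanged. *)
- apply: eq_inertia (neg_scale_inertia k_lt0 (polar_inertia hg)) => u v Vu Vv.
  by rewrite polar_opB // -pairingZ.
- move=> r m n t c d.
  (* [k \*: B] and [k^-1 \*: C] are [M] and [Minv] as bundled linear maps. *)
  rewrite (@lower_upper_contraction _ _ (k \*: B) (k^-1 \*: C)) //.
  by rewrite cpt_mkT (mulrC (m == d)%:R).
- move=> r m n t c d.
  rewrite (@upper_lower_contraction _ _ (k \*: B) (k^-1 \*: C)) //.
    by rewrite cpt_mkT (mulrC (m == d)%:R).
  by move=> Q VQ; rewrite memvZ ?VB.
Qed.
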